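(* Let $d\ge 3$ be an integer, let $K=(K_{ij})_{1\le i,j\le d-1}$ be a real symmetric matrix with $K_{ii}=0$ for all $i$, and suppose that $\kappa:=\max_{1\le i\le d-1}\sum_{j\ne i}|K_{ij}|\le \frac12$. Let $\pi_\beta$, $P_\beta$, $G$ and the projection chain $\overline{P_\beta}$ be as defined in the context. Then the following statements hold for every finite $\beta\ge 0$. 1. The original Metropolis dynamics satisfies $$\operatorname{gap}(P_\beta)\le \frac{1}{d\cosh^{d-1}(\beta(1-\kappa))}.$$ Consequently, for $0<\varepsilon<1/2$, $$t_{\mathrm{mix}}(P_\beta,\varepsilon)\ge \left[d\cosh^{d-1}(\beta(1-\kappa))-1\right]\log\frac{1}{2\varepsilon}.$$ 2. One has $$\operatorname{gap}(GP_\beta G)\ge \tfrac14\operatorname{gap}(\overline{P_\beta})\ge\frac{1-\kappa}{8d}\ge\frac{1}{16d},$$ $$\operatorname{gap}\left(\tfrac12(P_\beta+G)\right)\ge \tfrac18\operatorname{gap}(\overline{P_\beta})\ge\frac{1-\kappa}{16d}\ge\frac{1}{32d}.$$ 3. For $0<\varepsilon<1/2$, $$t_{\mathrm{mix}}(GP_\beta G,\varepsilon)\le\left\lceil\frac{8d}{1-\kappa}\left(\log\frac{1}{2\varepsilon}+\frac{d\log 2+\beta(2+\kappa)(d-1)}{2}\right)\right\rceil,$$ $$t_{\mathrm{mix}}\left(\tfrac12(P_\beta+G),\varepsilon\right)\le\left\lceil\frac{16d}{1-\kappa}\left(\log\frac{1}{2\varepsilon}+\frac{d\log 2+\beta(2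+\kappa)(d-1)}{2}\right)\right\rceil.$$
   Context: State space and target: $\mathcal X=\{-1,+1\}^d$, with configurations written $x=(x_0,x_1,\ldots,x_{d-1})$. The Hamiltonian is $$H(x)=-x_0\sum_{i=1}^{d-1}x_i-\sum_{1\le i<j\le d-1}K_{ij}x_ix_j,$$ and $\pi_\beta(x)=e^{-\beta H(x)}/\mathcal Z_\beta$ with $\mathcal Z_\beta=\sum_{x\in\mathcal X}e^{-\beta H(x)}$. Lazy Metropolis kernel: for $0\le i\le d-1$, $x^{(i)}$ denotes $x$ with the spin at index $i$ reversed. The kernel $P_\beta$ on $\mathcal X$ has $P_\beta(x,x^{(i)})=\frac{1}{2d}\min\{1,e^{-\beta[H(x^{(i)})-H(x)]}\}$ for $0\le i\le d-1$, $P_\beta(x,x)=1-\sum_{i=0}^{d-1}P_\beta(x,x^{(i)})$, and $P_\beta(x,y)=0$ otherwise. Orbit averaging: $R(x,y)=\mathbf 1_{\{y=-x\}}$ and $G=\frac12(I+R)$, kernels on $\mathcal X$. Kernels are multiplied as matrices. Projection chain: $\overline{P_\beta}$ is the Markov kernel on the set of orbits $\{x,-x\}$, $x\in\mathcal X$, given by $$\overline{P_\beta}(O,O')=\frac{1}{\pi_\beta(O)}\sum_{x\in O}\sum_{y\in O'}\pi_\beta(x)P_\beta(x,y),$$ which is reversible with respect to $\overline{\pi_\beta}(O)=\pi_\beta(O)$. Spectral gap: for a reversible kernel $T$ on a finite set, $\operatorname{gap}(T)=1-\lambda_2(T)$, where the (real) eigenvalues are ordered algebraically, with multiplicity, and $\lambda_2(T)$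 is the second largest one. Mixing time: for an ergodic kernel $T$ with stationary distribution $\mu$ and $\varepsilon>0$, $t_{\mathrm{mix}}(T,\varepsilon)=\min\{t\in\{0,1,2,\ldots\}:\max_x\|T^t(x,\cdot)-\mu\|_{\mathrm{TV}}\le\varepsilon\}$, where $\|\eta-\mu\|_{\mathrm{TV}}=\frac12\sum_x|\eta(x)-\mu(x)|$. *)

(* Defs.v *)
From mathcomp Require Import all_boot all_order all_algebra.
From mathcomp Require Import boolp classical_sets reals ereal sequences exp.

Set Implicit Arguments.
Unset Strict Implicit.
Unset Printing Implicit Defensive.
Import Order.TTheory GRing.Theory Num.Theory.
Local Open Scope ring_scope.

Section FiniteKernels.
Context {R : realType}.

Definition cosh (x : R) : R := (expR x + expR (- x)) / 2.

(* Kernels are square matrices, so that products and powers of kernels are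
   those of matrices; rows and columns follow the enumeration of [T]. *)
Definition kernel_mx (T : finType) (k : T -> T -> R) : 'M[R]_#|T| :=
  \matrix_(i, j) k (enum_val i) (enum_val j).

(* [s] lists the eigenvalues of [M] with multiplicity, in decreasing order. *)
Definition is_spectrum n (M : 'M[R]_n) (s : seq R) : Prop :=
  sorted >=%R s /\ char_poly M = \prod_(a <- s) ('X - a%:P).

(* There is at most one such list, and there is one for every reversible
   kernel; [[::]] is returned when the eigenvalues are not all real. *)
Definition spectrum n (M : 'M[R]_n) : seq R :=
  xget [::] [set s | is_spectrum M s].

Definition gap n (M : 'M[R]_n) : R := 1 - (spectrum M)`_1.

Definition tv (T : finType) (eta mu : T -> R) : R :=
  2^-1 * \sum_x `|eta x - mu x|.

(* The neutral element 0 of the maximum is harmless, as [tv] is nonnegative. *)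
Definition tv_distance (T : finType) (M : 'M[R]_#|T|) (mu : T -> R) (t : nat) : R :=
  \big[Num.max/0]_(x : T)
    tv (fun y => (M ^+ t) (enum_rank x) (enum_rank y)) mu.

(* Extended-real valued, so that the minimum over an empty set of times is
   [+oo]; over a nonempty set the infimum is attained. *)
Definition tmix (T : finType) (M : 'M[R]_#|T|) (mu : T -> R) (eps : R) : \bar R :=
  ereal_inf [set (t%:R)%:E | t in [set t : nat | tv_distance M mu t <= eps]].

End FiniteKernels.

(* A configuration on [d = m.+1] sites: site [0] is [ord0], and the site
   [i.+1] is [lift ord0 i] for [i : 'I_m]; [true] stands for the spin [+1].
   The interaction matrix [K] is indexed by the sites other than [0]. *)
Notation config m := {ffun 'I_m.+1 -> bool}.

Definition spin {R : realType} m (x : config m) (i : 'I_m.+1) : R :=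
  if x i then 1 else -1.

Definition flip m (i : 'I_m.+1) (x : config m) : config m :=
  [ffun j => if j == i then ~~ x j else x j].

Definition negc m (x : config m) : config m := [ffun j => ~~ x j].

Definition orbits m : {set {set config m}} :=
  [set [set x; negc x] | x : config m].

Notation orbit_space m := {O : {set config m} | O \in orbits m}.

Section Model.
Context {R : realType} {m : nat}.
Implicit Types (K : 'M[R]_m) (beta : R) (x y : config m).

Definition hamiltonian K x : R :=
  - spin x ord0 * (\sum_(i < m) spin x (lift ord0 i))
  - \sum_(i < m) \sum_(j < m | (i < j)%N)
      K i j * spin x (lift ord0 i) * spin x (lift ord0 j).

Definition kappa K : R := \big[Num.max/0]_(i < m) \sum_(j < m | j != i) `|K i j|.

Definition partition_fun K beta : R :=
  \sum_(x : config m) expR (- beta * hamiltonian K x).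

Definition gibbs K beta x : R :=
  expR (- beta * hamiltonian K x) / partition_fun K beta.

Definition flip_rate K beta x (i : 'I_m.+1) : R :=
  1 / (2 * m.+1%:R) *
  Num.min 1 (expR (- beta * (hamiltonian K (flip i x) - hamiltonian K x))).

(* The last sum has at most one term, and is 0 if [y] is not a flip of [x]. *)
Definition metropolis_fun K beta x y : R :=
  if y == x then 1 - \sum_i flip_rate K beta x i
  else \sum_(i | y == flip i x) flip_rate K beta x i.

Definition metropolis K beta : 'M[R]_#|{: config m}| :=
  kernel_mx (metropolis_fun K beta).

Definition projected_fun K beta (O O' : orbit_space m) : R :=
  1 / (\sum_(x in val O) gibbs K beta x) *
  \sum_(x in val O) \sum_(y in val O') gibbs K beta x * metropolis_fun K beta x y.

Definition projected K beta : 'M[R]_#|{: orbit_space m}| :=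
  kernel_mx (projected_fun K beta).

End Model.

Definition reversal (R : realType) (m : nat) : 'M[R]_#|{: config m}| :=
  kernel_mx (fun x y => (y == negc x)%:R).

Definition orbit_avg (R : realType) (m : nat) : 'M[R]_#|{: config m}| :=
  2^-1 *: (1%:M + reversal R m).

(* Main.v *)
(** The spin of the centre of the star is a bottleneck for the Metropolis
    dynamics: it has mean zero and, writing [w] for the Gibbs weights, its
    Dirichlet form is [1/d] times the mass of [min (w x) (w (flip 0 x))].
    Raising the field on the outer spins from [beta * kappa] to [beta], one
    spin at a time, multiplies the partition function by at least
    [cosh (beta (1 - kappa))] per spin, because at field [beta * kappa] every
    outer spin already prefers to agree with the centre.  The mixing bound
    follows from [<f, P f>^t <= <f, P^t f>], valid for the positive
    semidefinite kernel [P], without any eigenfunction.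

    On even functions the centre can be gauged away, and every outer spin then
    sees a field of size at least [1 - kappa >= 1/2].  There the heat bath has
    influences at most [|K_ij|], uniformly in [beta], since the logistic
    function has slope at most [1 / (4 beta)] beyond [beta].  Hence it contracts
    the Lipschitz seminorm by [1 - (1 - kappa) / (d - 1)], log-convexity of
    [t |-> <f, Q^t f>] turns this into a Poincaré inequality, and Metropolis
    dominates the heat bath.  Averaging over orbits only sees the even part of a
    function, so the inequality passes to [G P G] and to [(P + G) / 2]. *)
Require Import Defs.
From mathcomp Require Import all_boot all_order all_algebra.
From mathcomp Require Import complex.
From mathcomp Require Import boolp classical_sets reals ereal topology normedtype.
From mathcomp Require Import sequences derive realfun exp.
From mathcomp Require Import ring lra.
Set Implicit Arguments.
Unset Strict Implicit.
Unset Printing Implicit Defensive.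
Import Order.TTheory GRing.Theory Num.Theory.
Import numFieldNormedType.Exports.
Local Open Scope ring_scope.

(** * Spectra of reversible kernels *)

Section Spectral.
Context {R : realType} {n : nat}.
Implicit Types (M : 'M[R]_n) (p : 'I_n -> R).
Local Notation toC := (map_mx (real_complex R)).

Lemma toC_real m k (A : 'M[R]_(m, k)) : toC A \is a mxOver Num.real.
Proof. by apply/mxOverP => i j; rewrite mxE; apply/complex_realP; exists (A i j). Qed.

Lemma real_toC m k (A : 'M[R[i]]_(m, k)) :
  A \is a mxOver Num.real -> exists B, A = toC B.
Proof.
move=> /mxOverP h; exists (map_mx (@complex.Re R) A); apply/matrixP => i j.
by rewrite !mxE RRe_real.
Qed.

(** Diagonalise over the complex numbers, where a hermitian matrix has real eigenvalues; real
    matrices that are similar over the complex numbers are already similar over the reals. *)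
Lemma symmetric_diagonalizable (A : 'M[R]_n) : A^T = A ->
  exists P (D : 'rV[R]_n), P \in unitmx /\ P *m A = diag_mx D *m P.
Proof.
move=> Asym.
have CAsym : toC A \is symmetricmx.
  by apply/is_hermitianmxP; apply/matrixP => i j; rewrite expr0 scale1r !mxE -[in LHS]Asym mxE.
have CAherm : toC A \is hermsymmx by apply: realsym_hermsym (toC_real A).
have [L EL] := real_toC (hermitian_spectral_diag_real CAherm).
have /orthomx_spectralP EA := hermitian_normalmx CAherm.
rewrite EL in EA.
have [] := @real_similar R[i] n (toC A) (toC (diag_mx L)).
- exists (spectralmx (toC A)); first exact: spectral_unit.
  apply/similarP; first exact: spectral_unit.
  by rewrite {2}EA map_diag_mx !mulmxA mulmxV ?spectral_unit // mul1mx.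
- exact: toC_real.
- exact: toC_real.
move=> Q /andP[/real_toC [P ->]].
rewrite /= map_unitmx => uP /similarP; rewrite map_unitmx => /(_ uP).
rewrite -!map_mxM => /map_mx_inj; exists P, L; split => //; exact: H.
Qed.
End Spectral.

(** * Weighted inner products and detailed balance *)

Section WeightedInnerProduct.
Context {R : realType} {n : nat}.
Implicit Types (M : 'M[R]_n) (f g h : 'cV[R]_n).

Definition ip (p : 'I_n -> R) f g : R := \sum_i p i * (f i 0 * g i 0).

Definition reversible (p : 'I_n -> R) M := forall i j, p i * M i j = p j * M j i.

Variable p : 'I_n -> R.
Local Notation "<< f , g >>" := (ip p f g).

Lemma ipC f g : << f, g >> = << g, f >>.
Proof. by apply: eq_bigr => i _; rewrite (mulrC (f i 0)). Qed.

Lemma ipDl f g h : << f + g, h >> = << f, h >> + << g, h >>.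
Proof. by rewrite -big_split; apply: eq_bigr => i _ /=; rewrite !mxE; ring. Qed.

Lemma ipZl c f g : << c *: f, g >> = c * << f, g >>.
Proof. by rewrite mulr_sumr; apply: eq_bigr => i _ /=; rewrite !mxE; ring. Qed.

Lemma ipDr f g h : << f, g + h >> = << f, g >> + << f, h >>.
Proof. by rewrite !(ipC f) ipDl. Qed.

Lemma ipZr c f g : << f, c *: g >> = c * << f, g >>.
Proof. by rewrite !(ipC f) ipZl. Qed.

Lemma ipNr f g : << f, - g >> = - << f, g >>.
Proof. by rewrite -scaleN1r ipZr mulN1r. Qed.

Lemma ipBr f g h : << f, g - h >> = << f, g >> - << f, h >>.
Proof. by rewrite ipDr ipNr. Qed.

Lemma ip_suml (I : finType) (F : I -> 'cV[R]_n) g :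
  << \sum_i F i, g >> = \sum_i << F i, g >>.
Proof.
rewrite exchange_big /=; apply: eq_bigr => i _.
by rewrite summxE mulr_suml mulr_sumr.
Qed.

Lemma ip_sumr (I : finType) (F : I -> 'cV[R]_n) g :
  << g, \sum_i F i >> = \sum_i << g, F i >>.
Proof. by rewrite ipC ip_suml; apply: eq_bigr => i _; rewrite ipC. Qed.

Lemma ip_adjoint M f g : reversible p M -> << f, M *m g >> = << M *m f, g >>.
Proof.
move=> Mrev; transitivity (\sum_i \sum_j p i * M i j * f i 0 * g j 0).
  apply: eq_bigr => i _; rewrite mxE !mulr_sumr; apply: eq_bigr => j _; ring.
rewrite exchange_big; apply: eq_bigr => j _ /=.
by rewrite mxE mulr_suml mulr_sumr; apply: eq_bigr => i _; rewrite Mrev; ring.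
Qed.

Hypothesis p_gt0 : forall i, 0 < p i.

Lemma ip_ge0 f : 0 <= << f, f >>.
Proof. by apply: sumr_ge0 => i _; rewrite mulr_ge0 ?(ltW (p_gt0 i)) // -expr2 sqr_ge0. Qed.

Lemma ip_gt0 f : f != 0 -> 0 < << f, f >>.
Proof.
move=> f0; rewrite lt_def ip_ge0 andbT; apply: contraNneq f0 => /eqP.
rewrite psumr_eq0 => [/allP h|i _]; last first.
  by rewrite mulr_ge0 ?(ltW (p_gt0 i)) // -expr2 sqr_ge0.
apply/eqP/matrixP => i j; rewrite mxE ord1.
have := h i (mem_index_enum _).
by rewrite mulf_eq0 gt_eqF //= mulf_eq0 orbb => /eqP.
Qed.

(** Conjugation by the diagonal matrix of the [sqrt (p i)] turns detailed balance into symmetry. *)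
Lemma reversible_diagonalizable M : reversible p M ->
  exists P (D : 'rV[R]_n), P \in unitmx /\ P *m M = diag_mx D *m P.
Proof.
move=> Mrev.
pose q i := Num.sqrt (p i).
have q_gt0 i : 0 < q i by rewrite sqrtr_gt0.
have q0 i : q i != 0 by rewrite gt_eqF.
have qq i : p i = q i * q i by rewrite -expr2 sqr_sqrtr // ltW.
pose S := diag_mx (\row_i q i); pose S' := diag_mx (\row_i (q i)^-1).
have SS' : S *m S' = 1%:M.
  rewrite /S /S' mulmx_diag -diag_const_mx; congr diag_mx; apply/matrixP => i j.
  by rewrite !mxE divff.
have S'S : S' *m S = 1%:M by apply: mulmx1C.
have uS : S \in unitmx by case/mulmx1_unit: SS'.
have [|Q [D [uQ EQ]]] := @symmetric_diagonalizable R n (S *m M *m S').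
  apply/matrixP => i j; rewrite mxE.
  rewrite !mul_mx_diag !mul_diag_mx !mxE.
  have := Mrev i j; rewrite !qq => h.
  have -> : M j i = q i * q i * M i j / (q j * q j) by rewrite h; field; rewrite q0.
  by field; rewrite !q0.
exists (Q *m S), D; split; first by rewrite unitmx_mul uQ.
have : Q *m (S *m M *m S') *m S = diag_mx D *m Q *m S by rewrite EQ.
by rewrite -!mulmxA S'S mulmx1.
Qed.

End WeightedInnerProduct.

(** * The second eigenvalue of a diagonalisable matrix *)

Section Spectrum.
Context {R : realType} {n : nat}.
Implicit Types (M : 'M[R]_n).

Lemma char_poly_similar M (P : 'M[R]_n) (D : 'rV[R]_n) :
  P \in unitmx -> P *m M = diag_mx D *m P ->
  char_poly M = \prod_i ('X - (D 0 i)%:P).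
Proof.
move=> uP E.
transitivity (char_poly (diag_mx D)); last first.
  rewrite char_poly_trig ?is_diag_mx_is_trig ?diag_mx_is_diag //.
  by apply: eq_bigr => i _; rewrite mxE eqxx.
have uPC : \det (map_mx polyC P) != 0.
  by rewrite det_map_mx polyC_eq0 -unitfE -unitmxE.
apply: (mulfI uPC); rewrite [RHS]mulrC /char_poly -!det_mulmx; congr (\det _).
rewrite /char_poly_mx mulmxBr mulmxBl -!map_mxM E; congr (_ - _).
by rewrite -scalar_mxC.
Qed.

Lemma spectrumE M (s : seq R) : is_spectrum M s -> spectrum M = s.
Proof.
move=> [s_sorted s_char]; rewrite /spectrum.
case: xgetP => [s' _ [s'_sorted s'_char]|]; last first.
  by move=> /(_ s) []; split.
apply: (sorted_eq ge_trans ge_anti) => //.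
by apply: prod_XsubC_eq; rewrite -s_char s'_char.
Qed.

(** Indices are sorted rather than eigenvalues, so that a repeated top eigenvalue still yields two
    distinct indices, hence two independent eigenvectors. *)
Lemma spectrum_diag M (P : 'M[R]_n) (D : 'rV[R]_n) : (1 < n)%N ->
  P \in unitmx -> P *m M = diag_mx D *m P ->
  exists k0 k1, [/\ k0 != k1, (spectrum M)`_1 = D 0 k1, D 0 k1 <= D 0 k0
    & forall k, k != k0 -> D 0 k <= D 0 k1].
Proof.
move=> n1 uP E.
pose r (i j : 'I_n) := D 0 i >= D 0 j.
have rtot : total r by move=> i j; rewrite /r le_total.
have rtr : transitive r by move=> j i k; rewrite /r => h1 h2; exact: le_trans h2 h1.
pose ks := sort r (enum 'I_n).
have ks_sorted : sorted r ks by apply: sort_sorted.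
have ks_perm : perm_eq ks (enum 'I_n) by rewrite perm_sort.
have -> : spectrum M = [seq D 0 k | k <- ks].
  apply: spectrumE; split; first by rewrite sorted_map.
  rewrite (char_poly_similar uP E) big_map (perm_big _ ks_perm) /=.
  by rewrite big_enum.
have ks_uniq : uniq ks by rewrite (perm_uniq ks_perm) enum_uniq.
have ks_size : size ks = n by rewrite (perm_size ks_perm) size_enum_ord.
have ks_mem k : k \in ks by rewrite (perm_mem ks_perm) mem_enum.
case: ks ks_sorted {ks_perm} ks_uniq ks_size ks_mem => [|k0 [|k1 ks]] /=.
- by move=> _ _ n0; rewrite -n0 in n1.
- by move=> _ _ n0; rewrite -n0 in n1.
move=> /andP[r01 rs] /andP[]; rewrite inE negb_or => /andP[k01 _] _ _ km.
exists k0, k1; split => // k kk0.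
have := km k; rewrite !inE (negbTE kk0) /= => /predU1P[->//|].
by move: rs; rewrite (path_sortedE rtr) => /andP[/allP h _] /h.
Qed.

End Spectrum.

(** * Variational characterisation of the gap *)

Section MinMax.
Context {R : realType} {n : nat} (p : 'I_n -> R) (M : 'M[R]_n).
Hypotheses (n_gt1 : (1 < n)%N) (p_gt0 : forall i, 0 < p i).
Hypothesis Mrev : reversible p M.
Local Notation "<< f , g >>" := (ip p f g).
Local Notation one := (const_mx 1 : 'cV[R]_n).

Lemma eigenbasis : exists P (W : 'M[R]_n) (D : 'rV[R]_n),
  [/\ P *m W = 1%:M, W *m P = 1%:M, P *m M = diag_mx D *m P
    & forall k, M *m col k W = D 0 k *: col k W].
Proof.
have [P [D [uP E]]] := reversible_diagonalizable p_gt0 Mrev.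
exists P, (invmx P), D; rewrite mulmxV // mulVmx //; split => // k.
have EW : M *m invmx P = invmx P *m diag_mx D.
  by rewrite -[M](mulKmx uP) E !mulmxA mulmxK.
rewrite !colE mulmxA EW -colE; apply/matrixP => i j; rewrite -colE mul_mx_diag !mxE mulrC //.
Qed.

Lemma eigen_orthogonal (v w : 'cV[R]_n) a b : M *m v = a *: v -> M *m w = b *: w ->
  (a - b) * << v, w >> = 0.
Proof.
by move=> Ev Ew; rewrite mulrBl -ipZl -Ev -ip_adjoint // Ew ipZr subrr.
Qed.

(** Courant-Fischer: the span of the two leading eigenvectors contains a nonzero vector orthogonal
    to the constants, and its Rayleigh quotient is at least the second eigenvalue. *)
Lemma le_gap c : (forall f, << f, one >> = 0 ->
    c * << f, f >> <= << f, f >> - << f, M *m f >>) -> c <= gap M.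
Proof.
move=> hc; have [P [W [D [PW WP E EW]]]] := eigenbasis.
have uP : P \in unitmx by case/mulmx1_unit: PW.
have [k0 [k1 [k01 Es D01 _]]] := spectrum_diag n_gt1 uP E.
pose w0 := col k0 W; pose w1 := col k1 W.
have [a [b [ab w_one]]] : exists a b, (a != 0) || (b != 0) /\
    << a *: w0 + b *: w1, one >> = 0.
  have [e1|e1] := eqVneq << w1, one >> 0.
    by exists 0, 1; rewrite oner_eq0 orbT ipDl !ipZl e1; split => //; ring.
  by exists << w1, one >>, (- << w0, one >>); rewrite e1 ipDl !ipZl; split => //; ring.
set w := a *: w0 + b *: w1 in w_one.
have w_neq0 : w != 0.
  apply: contraTneq ab => w0eq.
  have Pw : P *m w = a *: delta_mx k0 0 + b *: delta_mx k1 0.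
    by rewrite /w /w0 /w1 mulmxDr -!scalemxAr !colE !mulmxA PW !mul1mx.
  have e0 := congr1 (fun A : 'cV[R]_n => A k0 0) Pw.
  have e1 := congr1 (fun A : 'cV[R]_n => A k1 0) Pw.
  move: e0 e1; rewrite w0eq mulmx0 !mxE !eqxx [k1 == k0]eq_sym (negbTE k01) /=.
  by rewrite !mulr1 !mulr0 addr0 add0r => <- <-; rewrite eqxx.
have hw := hc w w_one.
rewrite /gap Es.
have ww := ip_gt0 p_gt0 w_neq0.
(* Subtracting [D 0 k1] kills the [w1] component; the cross term that remains vanishes by
   [eigen_orthogonal], even if the two eigenvalues coincide. *)
have Mw : M *m w - D 0 k1 *: w = (a * (D 0 k0 - D 0 k1)) *: w0.
  rewrite /w mulmxDr -!scalemxAr !EW -/w0 -/w1.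
  by apply/matrixP => i j; rewrite !mxE; ring.
have : 0 <= << w, M *m w >> - D 0 k1 * << w, w >>.
  rewrite -ipZr -ipBr Mw ipZr {1}/w ipDl !ipZl.
  have o := eigen_orthogonal (EW k0) (EW k1); rewrite ipC -/w0 -/w1 in o.
  have -> : a * (D 0 k0 - D 0 k1) * (a * << w0, w0 >> + b * << w1, w0 >>)
     = a ^+ 2 * ((D 0 k0 - D 0 k1) * << w0, w0 >>)
       + a * b * ((D 0 k0 - D 0 k1) * << w1, w0 >>) by ring.
  by rewrite o mulr0 addr0 mulr_ge0 ?sqr_ge0 // mulr_ge0 ?subr_ge0 // ip_ge0.
by move=> h; rewrite -(ler_pM2r ww) mulrBl mul1r; lra.
Qed.

Hypothesis Mone : M *m one = one.
Hypothesis Mcontr : forall f, << f, M *m f >> <= << f, f >>.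

(** When the second eigenvalue is below 1, the fixed vector [one] is orthogonal to every eigenvector
    but the leading one. A mean-zero [f] then has no component along the latter and sees only
    eigenvalues up to the second. *)
Lemma gap_poincare f : << f, one >> = 0 ->
  gap M * << f, f >> <= << f, f >> - << f, M *m f >>.
Proof.
move=> f_one; have [P [W [D [PW WP E EW]]]] := eigenbasis.
have uP : P \in unitmx by case/mulmx1_unit: PW.
have [k0 [k1 [k01 Es D01 Dmax]]] := spectrum_diag n_gt1 uP E.
rewrite /gap Es mulrBl mul1r lerD2l lerN2.
(* A second eigenvalue of at least 1 makes the claim weaker than contraction. *)
have [le1s|lts1] := leP 1 (D 0 k1).
  by rewrite (le_trans (Mcontr f)) // ler_peMl // ip_ge0.
have decomp g : g = \sum_k (P *m g) k 0 *: col k W.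
  rewrite -{1}[g]mul1mx -WP -mulmxA; apply/matrixP => i j.
  by rewrite summxE mxE; apply: eq_bigr => k _; rewrite ord1 [RHS]mxE [col _ _ _ _]mxE mulrC.
have W_one k : k != k0 -> << col k W, one >> = 0.
  move=> kk0; have Mone1 : M *m one = 1 *: one by rewrite scale1r.
  have /eqP := eigen_orthogonal (EW k) Mone1.
  by rewrite mulf_eq0 subr_eq0 lt_eqF ?(le_lt_trans (Dmax k kk0)) //= => /eqP.
have W0_one : << col k0 W, one >> != 0.
  have one0 : one != 0.
    apply/eqP => /matrixP/(_ k0 0); rewrite !mxE; exact/eqP/oner_neq0.
  apply: contraTneq (ip_gt0 p_gt0 one0) => h.
  rewrite {1}[one]decomp ip_suml big1 ?ltxx // => k _; rewrite ipZl.
  by have [->|/W_one ->] := eqVneq k k0; rewrite ?h mulr0.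
set c := P *m f in decomp *.
have fE : f = \sum_k c k 0 *: col k W by exact: decomp.
have c0 : c k0 0 = 0.
  move: f_one; rewrite fE ip_suml (bigD1 k0) //= big1 => [|k kk0].
    by rewrite addr0 ipZl => /eqP; rewrite mulf_eq0 (negbTE W0_one) orbF => /eqP.
  by rewrite ipZl W_one // mulr0.
(* Off-diagonal inner products vanish unless the eigenvalues agree, so the form
   s - M is a square root away from the inner product. *)
pose r k := Num.sqrt (D 0 k1 - D 0 k).
pose z := \sum_k (c k 0 * r k) *: col k W.
suff : << f, D 0 k1 *: f - M *m f >> = << z, z >>.
  by move=> e; rewrite -subr_ge0 -ipZr -ipBr e ip_ge0.
have -> : D 0 k1 *: f - M *m f = \sum_k (c k 0 * (D 0 k1 - D 0 k)) *: col k W.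
  rewrite fE mulmx_sumr scaler_sumr -sumrB; apply: eq_bigr => k _.
  rewrite -scalemxAr EW.
  by apply/matrixP => i j; rewrite !mxE; ring.
rewrite {1}fE /z !ip_suml; apply: eq_bigr => j _.
rewrite !ip_sumr; apply: eq_bigr => k _; rewrite !ipZl !ipZr.
have [->|kk0] := eqVneq k k0; first by rewrite c0; ring.
have [->|jk0] := eqVneq j k0; first by rewrite c0; ring.
have /eqP := eigen_orthogonal (EW j) (EW k).
rewrite mulf_eq0 subr_eq0 => /predU1P[Djk|/eqP ->]; last by ring.
have -> : r j = r k by rewrite /r Djk.
have <- : r k * r k = D 0 k1 - D 0 k by rewrite -expr2 sqr_sqrtr // subr_ge0 Dmax.
by ring.
Qed.

End MinMax.

(** * Positive semidefinite kernels and mixing times *)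

Lemma reversible1 {R : realType} n (p : 'I_n -> R) : reversible p 1%:M.
Proof. by move=> i j; rewrite !mxE eq_sym; case: eqP => [->//|_]; rewrite !mulr0. Qed.

Section PositiveForms.
Context {R : realType}.

Lemma discriminant_le (a b e : R) : 0 <= e ->
  (forall c, 0 <= a + 2 * b * c + e * c ^+ 2) -> b ^+ 2 <= a * e.
Proof.
move=> e_ge0 h; have [e0|e_neq0] := eqVneq e 0.
  have [->|b0] := eqVneq b 0; first by rewrite e0; lra.
  (* With [e = 0] the polynomial is affine, and takes the value [-1] at this point. *)
  have := h (- (a + 1) / (2 * b)); rewrite e0 mul0r addr0.
  have -> : a + 2 * b * (- (a + 1) / (2 * b)) = -1 by field.
  by lra.
have e_gt0 : 0 < e by rewrite lt_def e_neq0.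
have := h (- b / e).
have -> : a + 2 * b * (- b / e) + e * (- b / e) ^+ 2 = (a * e - b ^+ 2) / e by field.
by rewrite pmulr_lge0 ?invr_gt0 // subr_ge0.
Qed.

(** Successive ratios of a log-convex sequence increase, so [a t / a 0] is at least
    [(a 1 / a 0) ^ t]. Denominators are cleared because terms may vanish. *)
Lemma logconvex_power (a : nat -> R) t :
  (forall t, 0 <= a t) -> (forall t, a t.+1 ^+ 2 <= a t * a t.+2) ->
  a 1%N ^+ t * a 0%N <= a t * a 0%N ^+ t.
Proof.
move=> a_ge0 a_conv.
have ratio k : a 1%N * a k <= a k.+1 * a 0%N.
  elim: k => [|k IHk]; first by rewrite mulrC.
  have [->|ak] := eqVneq (a k.+1) 0; first by rewrite mulr0 mulr_ge0.
  have ak_gt0 : 0 < a k.+1 by rewrite lt_def ak a_ge0.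
  rewrite -(ler_pM2l ak_gt0).
  apply: (@le_trans _ _ (a 1%N * (a k * a k.+2))).
    by rewrite mulrCA -expr2 ler_wpM2l.
  by rewrite [leRHS]mulrCA mulrA mulrC ler_wpM2l.
elim: t => [|t IHt]; first by rewrite !expr0 mul1r mulr1.
rewrite !exprS -mulrA; apply: (@le_trans _ _ (a 1%N * (a t * a 0%N ^+ t))).
  by rewrite ler_wpM2l.
by rewrite !mulrA ler_wpM2r // exprn_ge0.
Qed.

Context {n : nat}.
Implicit Types (f g : 'cV[R]_n).
Variables (p : 'I_n -> R) (M : 'M[R]_n).
Hypotheses (p_gt0 : forall i, 0 < p i) (Mrev : reversible p M).
Local Notation "<< f , g >>" := (ip p f g).

Lemma psd_cauchy (N : 'M[R]_n) f g : reversible p N ->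
  (forall h, 0 <= << h, N *m h >>) ->
  << f, N *m g >> ^+ 2 <= << f, N *m f >> * << g, N *m g >>.
Proof.
move=> Nrev Npsd; apply: discriminant_le => // c.
have := Npsd (f + c *: g).
rewrite mulmxDr -scalemxAr !(ipDl, ipDr, ipZl, ipZr).
have -> : << g, N *m f >> = << f, N *m g >> by rewrite ip_adjoint // ipC.
congr (_ <= _); ring.
Qed.

Lemma reversible_exp t : reversible p (M ^+ t).
Proof.
elim: t => [|t IHt] i j; first exact: reversible1.
rewrite {1}exprS exprSr !mxE !mulr_sumr; apply: eq_bigr => k _.
by rewrite mulrA Mrev mulrAC IHt; ring.
Qed.

Hypothesis Mpsd : forall f, 0 <= << f, M *m f >>.

(** Split [t] into two halves and a parity bit: by self-adjointness the form is that of [1] or of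
    [M] at [M ^+ t./2 *m f]. *)
Lemma psd_exp t f : 0 <= << f, M ^+ t *m f >>.
Proof.
rewrite -(odd_double_half t) addnC -addnn exprD exprD.
have -> : M ^+ t./2 * M ^+ t./2 * M ^+ odd t *m f
   = M ^+ t./2 *m (M ^+ odd t *m (M ^+ t./2 *m f)).
  by rewrite !mulmxA !mulmxE -!exprD; congr (_ ^+ _ *m _); rewrite addnAC.
rewrite ip_adjoint; last exact: reversible_exp.
by case: (odd t) => //; rewrite expr0 mul1mx ip_ge0.
Qed.

(** Jensen's inequality for the spectral measure of [f]. Cauchy-Schwarz for the form [M ^+ k], at
    [f] and [M *m f], makes [<f, M^k f>] log-convex in [k]. *)
Lemma psd_power_ge f t :
  << f, M *m f >> ^+ t * << f, f >> <= << f, M ^+ t *m f >> * << f, f >> ^+ t.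
Proof.
pose a t := << f, M ^+ t *m f >>.
have E0 : << f, f >> = a 0%N by rewrite /a expr0 mul1mx.
have E1 : << f, M *m f >> = a 1%N by rewrite /a expr1.
rewrite E0 E1; apply: (@logconvex_power a) => k; first exact: psd_exp.
have -> : a k.+1 = << f, M ^+ k *m (M *m f) >> by rewrite /a exprSr -mulmxE mulmxA.
have -> : a k.+2 = << M *m f, M ^+ k *m (M *m f) >>.
  by rewrite -ip_adjoint // /a exprSr exprS -!mulmxE !mulmxA.
by apply: psd_cauchy; [exact: reversible_exp | exact: psd_exp].
Qed.

Variable c : R.
Local Notation one := (const_mx 1 : 'cV[R]_n).
Hypothesis (Mone : M *m one = one).
Hypothesis poincare : forall f, << f, one >> = 0 ->
  c * << f, f >> <= << f, f >> - << f, M *m f >>.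

Lemma ip_mul_one f : << f, one >> = 0 -> << M *m f, one >> = 0.
Proof. by move=> f1; rewrite -ip_adjoint // Mone. Qed.

(** Cauchy-Schwarz for the form [M], at [f] and [M *m f], bounds the square of [x = <M f, M f>] by a
    product of two forms; Poincaré applies to each of them, and one factor [x] cancels. *)
Lemma contraction_step f : << f, one >> = 0 ->
  << M *m f, M *m f >> <= (1 - c) ^+ 2 * << f, f >>.
Proof.
move=> f1; set x := << _, _ >>.
have := psd_cauchy f (M *m f) Mrev Mpsd.
rewrite ip_adjoint // -/x => hx.
have h1 := poincare f1; have h2 := poincare (ip_mul_one f1); rewrite -/x in h2.
have x_ge0 : 0 <= x by apply: ip_ge0.
have [->|x0] := eqVneq x 0; first by rewrite mulr_ge0 ?sqr_ge0 ?ip_ge0.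
have x_gt0 : 0 < x by rewrite lt_def x0.
rewrite -(ler_pM2r x_gt0) -expr2 (le_trans hx) //.
have -> : (1 - c) ^+ 2 * << f, f >> * x = ((1 - c) * << f, f >>) * ((1 - c) * x) by ring.
by apply: ler_pM; rewrite ?Mpsd // mulrBl mul1r; lra.
Qed.

Lemma contraction t f : << f, one >> = 0 ->
  << M ^+ t *m f, M ^+ t *m f >> <= (1 - c) ^+ (2 * t) * << f, f >>.
Proof.
move=> f1.
have Mt1 k : << M ^+ k *m f, one >> = 0.
  elim: k => [|k IHk]; first by rewrite expr0 mul1mx.
  by rewrite exprS -mulmxE -mulmxA ip_mul_one.
elim: t => [|t IHt]; first by rewrite muln0 expr0 !mul1mx mul1r.
rewrite exprS -mulmxE -mulmxA (le_trans (contraction_step (Mt1 t))) //.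
by rewrite mulnS exprD -mulrA ler_wpM2l ?sqr_ge0.
Qed.

End PositiveForms.

(** * Total variation and mixing times *)

Section MixingBounds.
Context {R : realType} {T : finType}.
Variables (M : 'M[R]_#|T|) (mu : T -> R).
Local Notation p := (fun i : 'I_#|T| => mu (enum_val i)).
Local Notation one := (const_mx 1 : 'cV[R]_#|T|).
Hypotheses (mu_gt0 : forall x, 0 < mu x) (mu_sum : \sum_x mu x = 1).
Hypotheses (Mrev : reversible p M) (Mone : M *m one = one).
Hypothesis Mpsd : forall f, 0 <= ip p f (M *m f).

Lemma sum_enum_val (F : T -> R) : \sum_(i < #|T|) F (enum_val i) = \sum_x F x.
Proof. by rewrite -(big_enum_val F); apply: eq_bigl. Qed.

Lemma exp_mul_one t : M ^+ t *m one = one.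
Proof.
elim: t => [|t IHt]; first by rewrite expr0 mul1mx.
by rewrite exprS -mulmxE -mulmxA IHt.
Qed.

(** The classical [L^2] bound: total variation is half the [L^1] norm of the density minus 1, hence
    at most half its [L^2] norm, whose square shrinks by [(1 - c)^2] per step from at most
    [1 / mu x]. *)
Lemma tv_distance_le c eps t : 0 <= eps ->
  (forall f, ip p f one = 0 -> c * ip p f f <= ip p f f - ip p f (M *m f)) ->
  (forall x, (1 - c) ^+ (2 * t) <= (2 * eps) ^+ 2 * mu x) ->
  tv_distance M mu t <= eps.
Proof.
move=> eps0 hc heps; apply: bigmax_le => // x _.
set i := enum_rank x.
have p_gt0 j : 0 < p j by [].
have p_neq0 j : p j != 0 by rewrite gt_eqF.
have p_sum : \sum_j p j = 1 by rewrite sum_enum_val.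
(* The centred density, relative to [mu], of the point mass at [x]. *)
pose h0 : 'cV[R]_#|T| := (p i)^-1 *: delta_mx i 0 - one.
have ip_delta f : ip p (delta_mx i 0) f = p i * f i 0.
  rewrite /ip (bigD1 i) //= big1 => [|j ji]; first by rewrite mxE !eqxx mul1r addr0.
  by rewrite mxE (negbTE ji) mul0r mulr0.
have ip_one : ip p one one = 1.
  by rewrite /ip -[RHS]p_sum; apply: eq_bigr => j _; rewrite !mxE !mulr1.
have h0_one : ip p h0 one = 0.
  by rewrite ipC ipBr ipZr ip_one ipC ip_delta mxE mulr1 mulVf // subrr.
have h0_h0 : ip p h0 h0 <= (mu x)^-1.
  rewrite {2}/h0 ipBr h0_one subr0 ipZr ipC ip_delta !mxE !eqxx.
  rewrite mulrA mulVf // mul1r mulr1 /i enum_rankK; lra.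
(* Reversibility turns the [i]-th column of [M ^+ t], produced by [delta_mx], into its [i]-th row,
   which is the law started at [x]. *)
have hE j : (M ^+ t *m h0) j 0 = (M ^+ t) i j / p j - 1.
  rewrite mulmxBr exp_mul_one -scalemxAr -colE !mxE; congr (_ - _).
  have := reversible_exp Mrev t i j => /= e.
  by rewrite -[_ i j](mulKf (p_neq0 i)) e; field; rewrite !p_neq0.
set h := M ^+ t *m h0 in hE.
have tvE : tv (fun y => (M ^+ t) i (enum_rank y)) mu = 2^-1 * \sum_j p j * `|h j 0|.
  rewrite /tv -sum_enum_val; congr (_ * _); apply: eq_bigr => j _.
  rewrite enum_valK hE -{2}(gtr0_norm (p_gt0 j)) -normrM; congr `|_|.
  by field; rewrite p_neq0.
have hh : ip p h h <= (2 * eps) ^+ 2.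
  apply: (le_trans (contraction p_gt0 Mrev Mpsd Mone hc t h0_one)).
  apply: (@le_trans _ _ ((1 - c) ^+ (2 * t) * (mu x)^-1)).
    by rewrite ler_wpM2l // exprM exprn_ge0 // sqr_ge0.
  by rewrite ler_pdivrMr.
pose a : 'cV[R]_#|T| := \col_j `|h j 0|.
(* Cauchy-Schwarz against the constant 1, as the case of the identity kernel. *)
have h_cs : ip p a one ^+ 2 <= ip p a a * ip p one one.
  have := @psd_cauchy _ _ p 1%:M a one (reversible1 p); rewrite !mul1mx; apply => f.
  by rewrite mul1mx ip_ge0.
rewrite tvE.
have -> : \sum_j p j * `|h j 0| = ip p a one.
  by apply: eq_bigr => j _; rewrite !mxE mulr1.
have aa : ip p a a = ip p h h.
  by apply: eq_bigr => j _; rewrite !mxE -normrM ger0_norm // -expr2 sqr_ge0.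
rewrite mulrC ler_pdivrMr // mulrC -(@ler_pXn2r _ 2) ?nnegrE ?mulr_ge0 //.
  by rewrite (le_trans h_cs) // ip_one mulr1 aa.
apply: sumr_ge0 => j _; rewrite !mxE mulr1 mulr_ge0 //; exact/ltW.
Qed.

Lemma tmix_le eps t : tv_distance M mu t <= eps -> (tmix M mu eps <= t%:R%:E)%E.
Proof. by move=> h; apply: ereal_inf_lbound; exists t. Qed.

(** As [f] has mean zero, [mu] may be subtracted from each row of [M ^+ t]; as [f] is bounded by 1,
    this bounds [M^t f] pointwise by twice the distance. Pairing with [f] and [psd_power_ge]
    conclude. *)
Lemma tv_distance_ge (f : 'cV[R]_#|T|) t eps : (forall i, `|f i 0| <= 1) ->
  ip p f one = 0 -> ip p f f = 1 -> tv_distance M mu t <= eps ->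
  ip p f (M *m f) ^+ t <= 2 * eps.
Proof.
move=> f_le1 f_one f_f htv.
have p_gt0 j : 0 < p j by [].
have p_sum : \sum_j p j = 1 by rewrite sum_enum_val.
have := psd_power_ge p_gt0 Mrev Mpsd f t.
rewrite f_f expr1n !mulr1 => /le_trans; apply.
rewrite -[leRHS]mul1r -[X in _ <= X * _]p_sum mulr_suml; apply: ler_sum => i _.
rewrite ler_wpM2l ?(ltW (p_gt0 i)) //.
have Mf : (M ^+ t *m f) i 0 = \sum_j ((M ^+ t) i j - p j) * f j 0.
  rewrite mxE -[LHS]subr0; rewrite -[X in _ - X = _]f_one /ip -sumrB; apply: eq_bigr => j _.
  by rewrite [const_mx _ _ _]mxE mulr1 mulrBl.
apply: (le_trans (ler_norm _)); rewrite normrM.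
apply: (@le_trans _ _ `|(M ^+ t *m f) i 0|); first by rewrite ler_piMl.
rewrite Mf; apply: (le_trans (ler_norm_sum _ _ _)).
apply: (@le_trans _ _ (\sum_j `|(M ^+ t) i j - p j|)).
  by apply: ler_sum => j _; rewrite normrM ler_piMr.
apply: (@le_trans _ _ (2 * tv_distance M mu t)); last by rewrite ler_wpM2l.
apply: (@le_trans _ _ (2 * tv (fun y => (M ^+ t) (enum_rank (enum_val i)) (enum_rank y)) mu)).
  rewrite /tv mulrA divff ?mul1r // enum_valK -sum_enum_val.
  by apply: ler_sum => j _; rewrite enum_valK.
by rewrite ler_wpM2l //; apply: (le_bigmax_cond 0 (fun x => tv (fun y => (M ^+ t) (enum_rank x) (enum_rank y)) mu)).
Qed.

Lemma tmix_ge (f : 'cV[R]_#|T|) g eps : 0 < g < 1 -> 0 < eps ->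
  (forall i, `|f i 0| <= 1) -> ip p f one = 0 -> ip p f f = 1 ->
  1 - ip p f (M *m f) <= g ->
  (((1 / g - 1) * ln (1 / (2 * eps)))%:E <= tmix M mu eps)%E.
Proof.
move=> /andP[g0 g1] eps0 f_le1 f_one f_f fg; apply: le_ereal_inf_tmp => _ [t /= ht <-].
rewrite lee_fin.
have h1 : (1 - g) ^+ t <= 2 * eps.
  apply: le_trans (tv_distance_ge f_le1 f_one f_f ht).
  by apply: lerXn2r; rewrite ?nnegrE ?Mpsd //; lra.
have g'0 : 0 < 1 - g by lra.
have h2 : ln ((1 - g) ^+ t) <= ln (2 * eps) by rewrite ler_ln ?posrE ?exprn_gt0 ?mulr_gt0.
rewrite lnXn // in h2.
have -> : ln (1 / (2 * eps)) = - ln (2 * eps) by rewrite mul1r lnV // posrE mulr_gt0.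
(* The bound [ln (1 + y) <= y] at [y = g / (1 - g)]; it is the source of the factor [1 / g - 1]. *)
have h3 : - ln (1 - g) <= g / (1 - g).
  rewrite -lnV ?posrE //.
  have e : (1 - g)^-1 = 1 + g / (1 - g) by field; rewrite gt_eqF.
  rewrite [X in ln X]e.
  apply: le_ln1Dx; apply: (@lt_le_trans _ _ 0); rewrite ?ltrN10 // divr_ge0 // ltW //.
have h4 : - ln (2 * eps) <= t%:R * (g / (1 - g)).
  apply: (@le_trans _ _ (t%:R * - ln (1 - g))); last by apply: ler_wpM2l.
  by rewrite mulrN lerN2 [leLHS]mulr_natl.
have -> : (1 / g - 1) = (1 - g) / g by field; rewrite gt_eqF.
have -> : t%:R = (1 - g) / g * (t%:R * (g / (1 - g))) by field; rewrite !gt_eqF.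
by apply: ler_wpM2l => //; rewrite divr_ge0 // ltW.
Qed.

End MixingBounds.

(** * The star Ising model *)

Section Configurations.
Context {m : nat}.
Implicit Types x : config m.

Lemma flipK i : involutive (@flip m i).
Proof. by move=> x; apply/ffunP => j; rewrite !ffunE; case: eqP; rewrite ?negbK. Qed.

Lemma negcK : involutive (@negc m).
Proof. by move=> x; apply/ffunP => j; rewrite !ffunE negbK. Qed.

Lemma flip_negc i x : flip i (negc x) = negc (flip i x).
Proof. by apply/ffunP => j; rewrite !ffunE; case: eqP. Qed.

Lemma flipC i j x : flip i (flip j x) = flip j (flip i x).
Proof. by apply/ffunP => k; rewrite !ffunE; do 2![case: eqP]. Qed.

Lemma flip_neq i x : (flip i x == x) = false.
Proof. by apply/eqP => /ffunP/(_ i); rewrite ffunE eqxx; case: (x i). Qed.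

Lemma flip_eq i x y : (y == flip i x) = (x == flip i y).
Proof. by apply/eqP/eqP => ->; rewrite flipK. Qed.

Context {R : realType}.

Lemma spin_flip i j x :
  spin (flip i x) j = (if j == i then - spin x j else spin x j) :> R.
Proof. by rewrite /spin ffunE; case: eqP => // _; case: (x j) => //=; rewrite opprK. Qed.

Lemma spin_negc j x : spin (negc x) j = - spin x j :> R.
Proof. by rewrite /spin ffunE; case: (x j) => //=; rewrite opprK. Qed.

Lemma spin_sqr j x : spin x j * spin x j = 1 :> R.
Proof. by rewrite /spin; case: (x j); rewrite ?mulrNN mulr1. Qed.

Lemma normr_spin j x : `|spin x j| = 1 :> R.
Proof. by rewrite /spin; case: (x j); rewrite ?normrN normr1. Qed.

(** Symmetrisation over an involution: identities and inequalities between sums over configurations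
    need then only be checked on the pairs [x], [s x]. *)
Lemma sum_pair (F : config m -> R) (s : config m -> config m) : involutive s ->
  \sum_x F x = 2^-1 * \sum_x (F x + F (s x)).
Proof.
move=> sK; have Fs : \sum_x F (s x) = \sum_x F x by rewrite [RHS](reindex_inj (inv_inj sK)).
by rewrite big_split /= Fs -mulr2n -[X in _ * X]mulr_natl mulrA mulVf ?mul1r.
Qed.

Lemma eq_sum_pair (F G : config m -> R) (s : config m -> config m) :
  involutive s -> (forall x, F x + F (s x) = G x + G (s x)) ->
  \sum_x F x = \sum_x G x.
Proof.
move=> sK FG; rewrite (sum_pair F sK) (sum_pair G sK); congr (_ * _).
exact: eq_bigr.
Qed.

Lemma le_sum_pair (F G : config m -> R) (s : config m -> config m) :
  involutive s -> (forall x, F x + F (s x) <= G x + G (s x)) ->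
  \sum_x F x <= \sum_x G x.
Proof.
move=> sK FG; rewrite (sum_pair F sK) (sum_pair G sK) ler_wpM2l ?invr_ge0 //.
exact: ler_sum.
Qed.

End Configurations.

(** * Hamiltonian, local fields and Gibbs weights *)

Section Energy.
Context {R : realType} {m : nat} (K : 'M[R]_m) (beta : R).
Hypotheses (Ksym : K^T = K) (Kdiag : forall i, K i i = 0).
Implicit Types x : config m.
Local Notation s x i := (spin x (lift ord0 i) : R).
Local Notation k := (kappa K).

Definition star_sum x : R := \sum_(i < m) s x i.

Definition local_field x i : R := \sum_j K i j * s x j.

(** Half the sum over ordered pairs: for symmetric [K] with zero diagonal this is the interaction
    sum over [i < j], in a form where the effect of a flip is read off from one local field. *)
Definition pair_energy x : R := 2^-1 * \sum_i s x i * local_field x i.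

Lemma K_sym i j : K i j = K j i.
Proof. by rewrite -[in LHS]Ksym mxE. Qed.

Lemma hamiltonianE x :
  hamiltonian K x = - (spin x ord0 * star_sum x) - pair_energy x.
Proof.
rewrite /hamiltonian mulNr; congr (_ - _).
have tri i j : (i != j) = (i < j)%N || (j < i)%N by rewrite neq_ltn.
pose F i j := K i j * s x i * s x j.
rewrite /pair_energy.
have -> : \sum_i s x i * local_field x i =
    \sum_(i < m) \sum_(j < m | (i < j)%N) F i j + \sum_(i < m) \sum_(j < m | (j < i)%N) F i j.
  rewrite -big_split; apply: eq_bigr => i _ /=.
  rewrite mulr_sumr (bigID (fun j : 'I_m => (i < j)%N)) /=; congr (_ + _).
    by apply: eq_bigr => j _; rewrite /F; ring.
  rewrite (bigID (fun j : 'I_m => (j < i)%N)) /= [X in _ + X]big1 ?addr0.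
    apply: eq_big => [j|j _]; last by rewrite /F; ring.
    by rewrite -leqNgt; case: (ltnP j i) => [/ltnW ->|]; rewrite ?andbF.
  move=> j; rewrite -!leqNgt -eqn_leq => /eqP/val_inj ->.
  by rewrite Kdiag mul0r mulr0.
rewrite [X in _ + X](exchange_big_dep predT) //=.
have -> : \sum_(j < m) \sum_(i < m | (j < i)%N) F i j = \sum_(i < m) \sum_(j < m | (i < j)%N) F i j.
  by apply: eq_bigr => i _; apply: eq_bigr => j _; rewrite /F K_sym; ring.
by rewrite -mulr2n -[X in _ * X]mulr_natl mulrA mulVf ?mul1r.
Qed.

Lemma star_sum_flip0 x : star_sum (flip ord0 x) = star_sum x.
Proof. by apply: eq_bigr => i _; rewrite spin_flip. Qed.

Lemma local_field_flip0 x i : local_field (flip ord0 x) i = local_field x i.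
Proof. by apply: eq_bigr => j _; rewrite spin_flip. Qed.

Lemma pair_energy_flip0 x : pair_energy (flip ord0 x) = pair_energy x.
Proof.
congr (_ * _); apply: eq_bigr => i _.
by rewrite spin_flip local_field_flip0.
Qed.

Lemma star_sum_flip x i : star_sum (flip (lift ord0 i) x) = star_sum x - 2 * s x i.
Proof.
rewrite /star_sum (bigD1 i) //= [in RHS](bigD1 i) //= spin_flip eqxx.
rewrite (eq_bigr (fun j => s x j)) => [|j ji]; first by ring.
by rewrite spin_flip (inj_eq lift_inj) (negbTE ji).
Qed.

Lemma local_field_flip x i j :
  local_field (flip (lift ord0 i) x) j = local_field x j - 2 * K j i * s x i.
Proof.
rewrite /local_field (bigD1 i) //= [in RHS](bigD1 i) //= spin_flip eqxx.
rewrite (eq_bigr (fun l => K j l * s x l)) => [|l li]; first by ring.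
by rewrite spin_flip (inj_eq lift_inj) (negbTE li).
Qed.

Lemma pair_energy_flip x i :
  pair_energy (flip (lift ord0 i) x) = pair_energy x - 2 * s x i * local_field x i.
Proof.
rewrite /pair_energy (bigD1 i) //= [in RHS](bigD1 i) //= spin_flip eqxx.
rewrite local_field_flip Kdiag.
rewrite (eq_bigr (fun j => s x j * local_field x j - 2 * s x i * (K i j * s x j))).
  have -> : local_field x i = \sum_(j | j != i) K i j * s x j.
    by rewrite /local_field (bigD1 i) //= Kdiag mul0r add0r.
  by rewrite sumrB -mulr_sumr; field.
move=> j ji; rewrite spin_flip (inj_eq lift_inj) (negbTE ji) local_field_flip K_sym; ring.
Qed.

Lemma star_sum_negc x : star_sum (negc x) = - star_sum x.
Proof. by rewrite /star_sum -sumrN; apply: eq_bigr => i _; rewrite spin_negc. Qed.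

Lemma hamiltonian_negc x : hamiltonian K (negc x) = hamiltonian K x.
Proof.
rewrite !hamiltonianE star_sum_negc spin_negc mulrNN; congr (_ - _ * _).
apply: eq_bigr => i _; rewrite spin_negc /local_field !mulr_sumr.
by apply: eq_bigr => j _; rewrite spin_negc; ring.
Qed.

Lemma hamiltonian_flip x i : hamiltonian K (flip (lift ord0 i) x) =
  hamiltonian K x + 2 * s x i * (spin x ord0 + local_field x i).
Proof. by rewrite !hamiltonianE star_sum_flip pair_energy_flip spin_flip /=; ring. Qed.

Lemma sum_normK_le_kappa i : \sum_j `|K i j| <= k.
Proof.
rewrite (bigD1 i) //= Kdiag normr0 add0r.
exact: (le_bigmax_cond 0 (fun i => \sum_(j < m | j != i) `|K i j|)).
Qed.

Lemma kappa_ge0 : 0 <= k.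
Proof. by rewrite /kappa; apply: bigmax_ge_id. Qed.

Lemma local_field_le x i : `|local_field x i| <= k.
Proof.
apply: le_trans (sum_normK_le_kappa i); apply: (le_trans (ler_norm_sum _ _ _)).
by apply: ler_sum => j _; rewrite normrM normr_spin mulr1.
Qed.

Lemma star_sum_le x : `|star_sum x| <= m%:R.
Proof.
apply: (le_trans (ler_norm_sum _ _ _)).
by rewrite (eq_bigr (fun=> 1)) ?sumr_const ?card_ord // => i _; rewrite normr_spin.
Qed.

Lemma pair_energy_le x : `|pair_energy x| <= k * m%:R / 2.
Proof.
rewrite /pair_energy normrM mulrC [`|2^-1|]gtr0_norm ?invr_gt0 //.
apply: ler_wpM2r; first by rewrite invr_ge0.
apply: (le_trans (ler_norm_sum _ _ _)).
apply: (@le_trans _ _ (\sum_(i < m) k)).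
  by apply: ler_sum => i _; rewrite normrM normr_spin mul1r local_field_le.
by rewrite sumr_const card_ord mulr_natr.
Qed.

Lemma hamiltonian_sub_le x y :
  hamiltonian K x - hamiltonian K y <= (2 + k) * m%:R.
Proof.
have h z : `|hamiltonian K z| <= (2 + k) * m%:R / 2.
  rewrite hamiltonianE -opprD normrN (le_trans (ler_normD _ _)) //.
  rewrite normrM normr_spin mul1r.
  have := star_sum_le z; have := pair_energy_le z; lra.
have := ler_norm (hamiltonian K x); have := h x.
have := h y; rewrite -normrN; have := ler_norm (- hamiltonian K y); lra.
Qed.

Definition weight x : R := expR (- beta * hamiltonian K x).

Lemma weight_gt0 x : 0 < weight x. Proof. exact: expR_gt0. Qed.

Lemma weight_negc x : weight (negc x) = weight x.
Proof. by rewrite /weight hamiltonian_negc. Qed.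

Lemma partition_fun_gt0 : 0 < partition_fun K beta.
Proof.
rewrite /partition_fun (bigD1 [ffun=> true]) //=.
by rewrite ltr_pwDl ?weight_gt0 // sumr_ge0 // => x _; rewrite expR_ge0.
Qed.

Lemma gibbs_gt0 x : 0 < gibbs K beta x.
Proof. by rewrite divr_gt0 ?weight_gt0 ?partition_fun_gt0. Qed.

Lemma gibbs_sum : \sum_x gibbs K beta x = 1.
Proof. by rewrite -mulr_suml mulfV // gt_eqF // partition_fun_gt0. Qed.

Lemma gibbs_negc x : gibbs K beta (negc x) = gibbs K beta x.
Proof. by rewrite /gibbs hamiltonian_negc. Qed.

(** Each of the [2 ^ (m + 1)] terms of the partition function is at most [weight x] times the
    exponential of [beta] times the oscillation of the Hamiltonian. *)
Lemma gibbs_lower x : 0 <= beta ->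
  expR (- (m.+1%:R * ln 2 + beta * (2 + k) * m%:R)) <= gibbs K beta x.
Proof.
move=> beta_ge0; rewrite ler_pdivlMr ?partition_fun_gt0 //.
apply: (@le_trans _ _ (\sum_(y : config m)
   (expR (- beta * hamiltonian K x) * expR (- (m.+1%:R * ln 2))))).
  rewrite mulr_sumr; apply: ler_sum => y _.
  rewrite -!expRD ler_expR.
  have := ler_wpM2l beta_ge0 (hamiltonian_sub_le x y); lra.
rewrite sumr_const card_ffun card_bool card_ord expRN expRM_natl lnK ?posrE //.
by rewrite -mulrnAr -[_ *+ _]mulr_natr natrX mulVf ?mulr1 // expf_neq0.
Qed.

End Energy.

(** * Partition functions under a growing field *)

Section BottleneckRatio.
Context {R : realType} {m : nat} (K : 'M[R]_m) (beta : R).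
Hypotheses (Ksym : K^T = K) (Kdiag : forall i, K i i = 0).
Hypotheses (beta_ge0 : 0 <= beta) (kappa_le1 : kappa K <= 1).
Implicit Types x : config m.
Local Notation s x i := (spin x (lift ord0 i) : R).
Local Notation k := (kappa K).
Local Notation w := (weight K beta).
Local Notation c := (cosh (beta * (1 - k))).

Definition star_prefix (l : nat) x : R := \sum_(i < m | (i < l)%N) s x i.

(* The field on the outer spins is raised from [beta * kappa] to [beta] one
   outer spin at a time. *)
Definition prefix_exponent (l : nat) x : R :=
  beta * pair_energy K x + spin x ord0 *
    (beta * k * star_sum x + beta * (1 - k) * star_prefix l x).

Lemma star_prefixS (i : 'I_m) x : star_prefix i.+1 x = star_prefix i x + s x i.
Proof.
rewrite /star_prefix (bigD1 i) //= addrC; congr (_ + _).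
by apply: eq_bigl => j; rewrite ltnS [in RHS]ltn_neqAle andbC.
Qed.

Lemma star_prefix_flip (i : 'I_m) x :
  star_prefix i (flip (lift ord0 i) x) = star_prefix i x.
Proof.
apply: eq_bigr => j ji; rewrite spin_flip (inj_eq lift_inj).
by case: eqP => // e; rewrite e ltnn in ji.
Qed.

(** Pair [x] with its flip at the outer site [i], say with exponents [u] and [u']. If the centre and
    the spin at that site agree in [x], twice the gain of the pair is [(e^u - e^u') (e^b - e^-b)].
    This is nonnegative because the field [beta * kappa] of the centre outweighs the local field;
    the other case is symmetric. *)
Lemma prefix_step (i : 'I_m) :
  c * \sum_x expR (prefix_exponent i x) <= \sum_x expR (prefix_exponent i.+1 x).
Proof.
rewrite mulr_sumr; apply: (le_sum_pair (flipK (lift ord0 i))) => x.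
pose b := beta * (1 - k).
have b_ge0 : 0 <= b by rewrite mulr_ge0 // subr_ge0.
pose E := prefix_exponent i.
have ES y : prefix_exponent i.+1 y = E y + b * (spin y ord0 * s y i).
  by rewrite /E /prefix_exponent star_prefixS /b; ring.
have Eflip : E (flip (lift ord0 i) x) =
    E x - 2 * beta * (s x i * local_field K x i + k * (spin x ord0 * s x i)).
  rewrite /E /prefix_exponent pair_energy_flip // spin_flip star_sum_flip star_prefix_flip /=.
  by ring.
rewrite !ES !spin_flip eqxx /=.
rewrite -![prefix_exponent i _]/(E _).
have := local_field_le Kdiag x i; rewrite ler_norml => /andP[loc1 loc2].
move: (E x) (E (flip _ x)) Eflip => u u' Eflip {ES E}.
have eb : expR (- b) <= expR b by rewrite ler_expR; lra.
have slack a a' : a <= a' -> 0 <= (expR a' - expR a) * (expR b - expR (- b)).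
  by move=> aa'; rewrite mulr_ge0 // subr_ge0 // ler_expR.
rewrite /cosh -/b.
have s_loc : - k <= s x i * local_field K x i <= k.
  by rewrite /spin; case: (x _); rewrite ?mulN1r ?mul1r; apply/andP; split; lra.
case/andP: s_loc => sl1 sl2.
have [e|e] : spin x ord0 * s x i = 1 \/ spin x ord0 * s x i = -1.
  by rewrite /spin; case: (x _); case: (x _); rewrite ?mulN1r ?mul1r ?opprK; auto.
- rewrite mulrN e mulr1 mulrN1 !expRD; rewrite e in Eflip.
  suff /slack : u' <= u by lra.
  by rewrite Eflip mulr1 lerBlDr lerDl !mulr_ge0 //; lra.
- rewrite mulrN e mulrN1 opprK mulr1 !expRD; rewrite e in Eflip.
  suff /slack : u <= u' by lra.
  by rewrite Eflip lerDl oppr_ge0 mulr_ge0_le0 ?mulr_ge0 //; lra.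
Qed.

Lemma cosh_ge0 (y : R) : 0 <= cosh y.
Proof. by rewrite /cosh mulr_ge0 ?addr_ge0 ?expR_ge0. Qed.

Lemma prefix_sum (l : nat) : (l <= m)%N ->
  c ^+ l * \sum_x expR (prefix_exponent 0 x) <= \sum_x expR (prefix_exponent l x).
Proof.
elim: l => [|l IHl] lm; first by rewrite expr0 mul1r.
rewrite exprS -mulrA; apply: le_trans (prefix_step (Ordinal lm)).
by apply: ler_wpM2l; rewrite ?cosh_ge0 // IHl // ltnW.
Qed.

(** Flipping the centre only reverses the field term [y], and [e^y + e^-y >= 2]. *)
Lemma sum_pair_energy_le :
  \sum_x expR (beta * pair_energy K x) <= \sum_x expR (prefix_exponent 0 x).
Proof.
apply: (le_sum_pair (flipK ord0)) => x.
rewrite /prefix_exponent spin_flip eqxx pair_energy_flip0 star_sum_flip0.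
have p0 z : star_prefix 0 z = 0 by rewrite /star_prefix big1.
rewrite !p0 mulr0 addr0 mulNr !expRD.
set a := expR (beta * _); set y := spin x ord0 * _.
have a_ge0 : 0 <= a by apply: expR_ge0.
have := expR_ge1Dx y; have := expR_ge1Dx (- y).
rewrite -!mulrDr => h1 h2; rewrite -mulr2n -mulr_natr; apply: ler_wpM2l => //; lra.
Qed.

(** The two weights are [exp (beta * pair_energy)] times reciprocal factors, so their minimum is at
    most this weight without field, which [prefix_sum] compares with the full field. *)
Lemma sum_min_weight_le :
  c ^+ m * \sum_x Num.min (w x) (w (flip ord0 x)) <= partition_fun K beta.
Proof.
(* At [l = m] the two fields add up to [beta] on every outer spin. *)
have -> : partition_fun K beta = \sum_x expR (prefix_exponent m x).
  apply: eq_bigr => x _; congr expR; rewrite hamiltonianE // /prefix_exponent.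
  rewrite (_ : star_prefix m x = star_sum x); first by ring.
  by apply: eq_bigl => i; rewrite ltn_ord.
apply: le_trans (prefix_sum (leqnn m)).
apply: ler_wpM2l; first by rewrite exprn_ge0 // cosh_ge0.
apply: le_trans sum_pair_energy_le.
apply: ler_sum => x _; rewrite /weight !hamiltonianE // pair_energy_flip0 star_sum_flip0.
rewrite spin_flip eqxx ge_min !ler_expR.
have [h|h] := leP (beta * (spin x ord0 * star_sum x)) 0.
  by apply/orP; left; lra.
by apply/orP; right; lra.
Qed.

End BottleneckRatio.

(** * The Metropolis kernel *)

Section FunctionVectors.
Context {R : realType} {T : finType}.
Implicit Types (f g mu : T -> R) (k : T -> T -> R).

Definition vec f : 'cV[R]_#|T| := \col_i f (enum_val i).

Definition on_index mu (i : 'I_#|T|) : R := mu (enum_val i).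

Lemma vecE (v : 'cV[R]_#|T|) : v = vec (fun x => v (enum_rank x) 0).
Proof. by apply/matrixP => i j; rewrite mxE enum_valK ord1. Qed.

Lemma eq_vec f g : f =1 g -> vec f = vec g.
Proof. by move=> fg; apply/matrixP => i j; rewrite !mxE fg. Qed.

Lemma vec1 : const_mx 1 = vec (fun=> 1).
Proof. by apply/matrixP => i j; rewrite !mxE. Qed.

Lemma ip_vec mu f g : ip (on_index mu) (vec f) (vec g) = \sum_x mu x * (f x * g x).
Proof. by rewrite -[RHS]sum_enum_val; apply: eq_bigr => i _; rewrite !mxE. Qed.

Lemma kernel_mul_vec k f : kernel_mx k *m vec f = vec (fun x => \sum_y k x y * f y).
Proof.
apply/matrixP => i j; rewrite !mxE -[RHS]sum_enum_val.
by apply: eq_bigr => l _; rewrite !mxE.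
Qed.

Lemma kernel_reversible mu k : (forall x y, mu x * k x y = mu y * k y x) ->
  reversible (on_index mu) (kernel_mx k).
Proof. by move=> h i j; rewrite !mxE; exact: h. Qed.

End FunctionVectors.

Section Metropolis.
Context {R : realType} {m : nat} (K : 'M[R]_m) (beta : R).
Implicit Types (x y : config m) (f g : config m -> R).
Local Notation w := (weight K beta).
Local Notation Z := (partition_fun K beta).
Local Notation pi := (gibbs K beta).
Local Notation p := (on_index pi).
Local Notation P := (metropolis K beta).
Local Notation D := (m.+1%:R : R).
Local Notation "<< f , g >>" := (ip p f g).

(** Up to the factor [1 / (2 D Z)], the equilibrium flow between [x] and [flip i x]. *)
Definition edge x i : R := Num.min (w x) (w (flip i x)).

Lemma edge_flip x i : edge (flip i x) i = edge x i.
Proof. by rewrite /edge flipK minC. Qed.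

Lemma edge_ge0 x i : 0 <= edge x i.
Proof. by rewrite /edge le_min !ltW ?weight_gt0. Qed.

Lemma edge_le x i : edge x i <= w x.
Proof. by rewrite /edge ge_min lexx. Qed.

Lemma gibbs_flip_rate x i : pi x * flip_rate K beta x i = edge x i / (2 * D * Z).
Proof.
have Z_gt0 : 0 < Z := partition_fun_gt0 K beta.
rewrite /gibbs /flip_rate /edge.
have -> : w (flip i x) = w x * expR (- beta * (hamiltonian K (flip i x) - hamiltonian K x)).
  by rewrite /weight -expRD; congr expR; ring.
rewrite -[X in Num.min X (_ * _)]mulr1 -minr_pMr ?ltW ?weight_gt0 //.
by rewrite /weight; field; rewrite gt_eqF //=.
Qed.

Lemma metropolis_fun_apply f x : \sum_y metropolis_fun K beta x y * f y =
  f x + \sum_i flip_rate K beta x i * (f (flip i x) - f x).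
Proof.
rewrite (bigD1 x) //= {1}/metropolis_fun eqxx.
have -> : \sum_(y | y != x) metropolis_fun K beta x y * f y =
    \sum_i flip_rate K beta x i * f (flip i x).
  transitivity (\sum_(y | y != x) \sum_(i | y == flip i x) flip_rate K beta x i * f y).
    by apply: eq_bigr => y yx; rewrite /metropolis_fun (negbTE yx) mulr_suml.
  rewrite (exchange_big_dep predT) //=; apply: eq_bigr => i _.
  rewrite (bigD1 (flip i x)) /=; last by rewrite flip_neq eqxx.
  rewrite big1 ?addr0 // => y /andP[/andP[_ /eqP ->]]; by rewrite eqxx.
rewrite mulrBl mul1r mulr_suml -addrA -sumrN -big_split /=.
by congr (_ + _); apply: eq_bigr => i _; ring.
Qed.

Lemma metropolis_mul_vec f : P *m vec f =
  vec (fun x => f x + \sum_i flip_rate K beta x i * (f (flip i x) - f x)).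
Proof. by rewrite kernel_mul_vec; apply: eq_vec => x; exact: metropolis_fun_apply. Qed.

Lemma metropolis_one : P *m const_mx 1 = const_mx 1 :> 'cV_#|{: config m}|.
Proof.
rewrite vec1 metropolis_mul_vec; apply: eq_vec => x.
by rewrite big1 ?addr0 // => i _; rewrite subrr mulr0.
Qed.

Lemma metropolis_balance x y :
  pi x * metropolis_fun K beta x y = pi y * metropolis_fun K beta y x.
Proof.
rewrite /metropolis_fun eq_sym; have [->//|_] := eqVneq x y.
rewrite !mulr_sumr; apply: eq_big => [i|i /eqP ->]; first by rewrite flip_eq.
by rewrite !gibbs_flip_rate edge_flip.
Qed.

Lemma metropolis_reversible : reversible p P.
Proof. by apply: kernel_reversible; exact: metropolis_balance. Qed.

(** The flow contributes [2 D Z] to the constant, and the symmetrisation of each edge another factor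
    2. *)
Lemma metropolis_dirichlet f : << vec f, vec f >> - << vec f, P *m vec f >> =
  (4 * D * Z)^-1 * \sum_i \sum_x edge x i * (f x - f (flip i x)) ^+ 2.
Proof.
rewrite metropolis_mul_vec !ip_vec -sumrB.
transitivity (\sum_i \sum_x edge x i / (2 * D * Z) * (f x * (f x - f (flip i x)))).
  rewrite [RHS]exchange_big; apply: eq_bigr => x _ /=.
  rewrite mulrDr mulrDr opprD addrA subrr add0r 2!mulr_sumr -sumrN.
  by apply: eq_bigr => i _; rewrite -gibbs_flip_rate; ring.
rewrite [RHS]mulr_sumr; apply: eq_bigr => i _; rewrite [RHS]mulr_sumr.
apply: (eq_sum_pair (flipK i)) => x; rewrite edge_flip flipK.
have Z_gt0 : 0 < Z := partition_fun_gt0 K beta.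
by field; rewrite gt_eqF //=.
Qed.

Lemma metropolis_contracts (v : 'cV_#|{: config m}|) : << v, P *m v >> <= << v, v >>.
Proof.
rewrite (vecE v) -subr_ge0 metropolis_dirichlet.
have Z_gt0 : 0 < Z := partition_fun_gt0 K beta.
rewrite mulr_ge0 ?invr_ge0 ?mulr_ge0 ?(ltW Z_gt0) //.
by do 2![apply: sumr_ge0 => ? _]; rewrite mulr_ge0 ?edge_ge0 ?sqr_ge0.
Qed.

(** This is laziness: since [(a - b)^2 <= 2 a^2 + 2 b^2] and [edge] is at most either weight, the
    Dirichlet form is at most [<f, f>]. *)
Lemma metropolis_psd (v : 'cV_#|{: config m}|) : 0 <= << v, P *m v >>.
Proof.
rewrite (vecE v); set f := fun x => _.
have Z_gt0 : 0 < Z := partition_fun_gt0 K beta.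
have D_gt0 : 0 < D by [].
suff : (4 * D * Z)^-1 * \sum_i \sum_x edge x i * (f x - f (flip i x)) ^+ 2 <=
    << vec f, vec f >> by rewrite -metropolis_dirichlet; lra.
rewrite ip_vec mulrC ler_pdivrMr ?mulr_gt0 //.
apply: (@le_trans _ _ (\sum_(i < m.+1) \sum_x 4 * (w x * f x ^+ 2))).
  apply: ler_sum => i _; apply: (le_sum_pair (flipK i)) => x.
  rewrite edge_flip flipK.
  have h1 := edge_le x i; have h2 := edge_le (flip i x) i; rewrite edge_flip in h2.
  have := edge_ge0 x i; set e := edge x i in h1 h2 *; move=> e0.
  have l1 : e * f x ^+ 2 <= w x * f x ^+ 2 by rewrite ler_wpM2r ?sqr_ge0.
  have l2 : e * f (flip i x) ^+ 2 <= w (flip i x) * f (flip i x) ^+ 2.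
    by rewrite ler_wpM2r ?sqr_ge0.
  have l3 : 0 <= e * (f x + f (flip i x)) ^+ 2 by rewrite mulr_ge0 ?sqr_ge0.
  lra.
have -> : \sum_x pi x * (f x * f x) = Z^-1 * \sum_x w x * f x ^+ 2.
  by rewrite [RHS]mulr_sumr; apply: eq_bigr => x _; rewrite /gibbs /weight; field; rewrite gt_eqF.
rewrite sumr_const card_ord -[leLHS]mulr_natl -mulr_sumr.
by rewrite le_eqVlt; apply/orP; left; apply/eqP; field; rewrite gt_eqF.
Qed.

End Metropolis.

(** * Poincaré inequality on even functions *)

Section Logistic.
Context {R : realType}.

(** For [v >= 1/2], multiply [e^(3/2) >= 4] by [e^(v - 3/2) >= 1 + (v - 3/2)]. *)
Lemma expR_ge_affine (v : R) : 4 * v - 2 <= expR v.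
Proof.
have [v_lt|v_ge] := ltP v (1 / 2); first by apply: (@le_trans _ _ 0); [lra | exact: expR_ge0].
(* From [e^(1/8) >= 9/8], rational bounds are carried through the powers 2, 4 and 8; then
   [12 = 4 + 8] and [8/5 * 64/25 > 4]. *)
have e4 : 4 <= expR (3 / 2 : R).
  have -> : (3 / 2 : R) = 12%:R * (1 / 8) by field.
  rewrite expRM_natl (exprM _ 2 6) (exprM _ 2 3); set e := expR _.
  have e1 : 9 / 8 <= e by have := expR_ge1Dx (1 / 8 : R); rewrite -/e; lra.
  have e2 : 81 / 64 <= e ^+ 2 by rewrite expr2; nra.
  have e4 : 8 / 5 <= (e ^+ 2) ^+ 2 by rewrite [leRHS]expr2; nra.
  have e8 : 64 / 25 <= ((e ^+ 2) ^+ 2) ^+ 2 by rewrite [leRHS]expr2; nra.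
  by rewrite exprS; nra.
have -> : expR v = expR (3 / 2) * expR (v - 3 / 2) by rewrite -expRD; congr expR; ring.
apply: (@le_trans _ _ (4 * expR (v - 3 / 2))).
  by have := expR_ge1Dx (v - 3 / 2); lra.
by rewrite ler_wpM2r ?expR_ge0.
Qed.

(** By the mean value theorem it suffices that [v + 4 b / (1 + e^v)] has nonnegative slope at
    [c >= b]; indeed [4 b e^c <= (e^c + 2) e^c <= (1 + e^c)^2] by the affine bound. *)
Lemma logistic_lipschitz (b A B : R) : b <= A -> A <= B ->
  4 * b * ((1 + expR A)^-1 - (1 + expR B)^-1) <= B - A.
Proof.
move=> bA AB.
pose f (v : R) := v + (4 * b) * (1 + expR v)^-1.
pose df (v : R) := 1 - (4 * b) * (expR v / (1 + expR v) ^+ 2).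
have pos (v : R) : 0 < 1 + expR v by rewrite addr_gt0 ?expR_gt0.
have fd (v : R) : is_derive v 1 f (df v).
  have v0 : 1 + expR v != 0 by rewrite gt_eqF.
  have d1 : is_derive v (1 : R) (fun v : R => 1 + expR v) (expR v).
    by apply: is_derive_eq; rewrite add0r mul1r.
  have d2 := @is_deriveV _ (fun v : R => 1 + expR v) v _ 1 v0 d1.
  apply: (@is_derive_eq _ _ _ _ _ _ _ _ (is_deriveD (is_derive_id v 1) (is_deriveZ (4 * b) d2))).
  by rewrite /df /GRing.scale /=; field.
have [|c /[!in_itv]/= /andP[Ac cB] E] := @MVT_segment R f df A B AB (fun v _ => fd v).
  apply: derivable_within_continuous => v _; exact: (@ex_derive _ _ _ _ _ _ _ (fd v)).
have : 0 <= df c.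
  rewrite /df subr_ge0 mulrA ler_pdivrMr ?exprn_gt0 // mul1r.
  have := expR_ge_affine c; have := expR_ge0 c; nra.
have : 0 <= B - A by rewrite subr_ge0.
move: E; rewrite /f; nra.
Qed.
End Logistic.

(** Constants do not affect exponential rates: if [r > a], Bernoulli's inequality makes [(r / a)^t]
    grow at least linearly, past any [C]. *)
Lemma geometric_dominated {R : realType} (a r C : R) : 0 <= r -> 0 < a ->
  (forall t, r ^+ t <= C * a ^+ t) -> r <= a.
Proof.
move=> r_ge0 a_gt0 h; rewrite leNgt; apply/negP => ar.
pose e := r / a - 1.
have e_gt0 : 0 < e by rewrite subr_gt0 ltr_pdivlMr // mul1r.
have bern t : 1 + t%:R * e <= (r / a) ^+ t.
  elim: t => [|t IHt]; first by rewrite mul0r addr0 expr0.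
  have ra : r / a = 1 + e by rewrite /e; ring.
  rewrite exprS; apply: (@le_trans _ _ (r / a * (1 + t%:R * e))).
    rewrite ra -natr1; have : 0 <= t%:R * e * e by rewrite !mulr_ge0 // ltW.
    lra.
  by apply: ler_wpM2l => //; rewrite divr_ge0 // ltW.
have C_ge t : 1 + t%:R * e <= C.
  apply: le_trans (bern t) _; rewrite expr_div_n ler_pdivrMr ?exprn_gt0 //.
have [N CN] : exists N : nat, `|C / e| < N%:R.
  by exists (Num.bound `|C / e|); exact: archi_boundP.
have := C_ge N; have := ler_norm (C / e); move: CN => CN Ce.
have : C / e < N%:R by apply: le_lt_trans CN.
rewrite ltr_pdivrMr //; lra.
Qed.

(** * The heat bath on the outer spins *)

Section HeatBath.
Context {R : realType} {m : nat} (K : 'M[R]_m) (beta : R).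
Hypotheses (Ksym : K^T = K) (Kdiag : forall i, K i i = 0).
Hypotheses (beta_ge0 : 0 <= beta) (hkappa : kappa K <= 1 / 2) (m_gt0 : (0 < m)%N).
Implicit Types (x y : config m) (f g : config m -> R).
Local Notation w := (weight K beta).
Local Notation Z := (partition_fun K beta).
Local Notation pi := (gibbs K beta).
Local Notation p := (on_index pi).
Local Notation P := (metropolis K beta).
Local Notation k := (kappa K).
Local Notation M := (m%:R : R).
Local Notation fl i := (flip (lift ord0 i)).
Local Notation "<< f , g >>" := (ip p f g).

Definition resample_prob (x : config m) (i : 'I_m) : R := w (fl i x) / (w x + w (fl i x)).
Local Notation a := resample_prob.

(** Only outer spins are resampled. The centre is never moved: an even function is determined by its
    values at a fixed centre. *)
Definition heat_fun x y : R :=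
  M^-1 * \sum_i ((1 - a x i) * (y == x)%:R + a x i * (y == fl i x)%:R).

Definition heat_bath : 'M[R]_#|{: config m}| := kernel_mx heat_fun.
Local Notation Q := heat_bath.

(** The conditional expectation of [f] given all spins but the [i]-th outer one. *)
Definition resample f (i : 'I_m) x : R := f x + a x i * (f (fl i x) - f x).

Let w_gt0 x : 0 < w x. Proof. exact: weight_gt0. Qed.
Let ww_neq0 x i : w x + w (fl i x) != 0.
Proof. by rewrite gt_eqF // addr_gt0. Qed.

Let gibbsE x : pi x = w x / Z. Proof. by []. Qed.
Let Z_neq0 : Z != 0. Proof. by rewrite gt_eqF // partition_fun_gt0. Qed.
Let Z_gt0 : 0 < Z := partition_fun_gt0 K beta.
Let M_neq0 : M != 0. Proof. by rewrite pnatr_eq0 -lt0n. Qed.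
Let M_gt0 : 0 < M. Proof. by rewrite ltr0n. Qed.

Lemma resample_prob_flip x i : a (fl i x) i = 1 - a x i.
Proof. by rewrite /a flipK; field; rewrite ww_neq0 // addrC ww_neq0. Qed.

Lemma resample_prob_ge0 x i : 0 <= a x i.
Proof. by rewrite divr_ge0 ?addr_ge0 // ltW. Qed.

Lemma resample_prob_le1 x i : a x i <= 1.
Proof. by rewrite -subr_ge0 -resample_prob_flip resample_prob_ge0. Qed.

Lemma resample_prob_negc x i : a (negc x) i = a x i.
Proof. by rewrite /a flip_negc !weight_negc. Qed.

Lemma heat_mul_vec f : Q *m vec f = vec (fun x => M^-1 * \sum_i resample f i x).
Proof.
rewrite kernel_mul_vec; apply: eq_vec => x.
transitivity (\sum_y M^-1 * \sum_i ((1 - a x i) * (y == x)%:R + a x i * (y == fl i x)%:R) * f y).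
  by apply: eq_bigr => y _; rewrite /heat_fun -mulrA mulr_suml.
rewrite -mulr_sumr exchange_big; congr (_ * _); apply: eq_bigr => i _ /=.
have delta z : \sum_y (y == z)%:R * f y = f z.
  rewrite (bigD1 z) //= eqxx mul1r big1 ?addr0 // => y /negbTE ->; exact: mul0r.
rewrite (eq_bigr (fun y => (1 - a x i) * ((y == x)%:R * f y) + a x i * ((y == fl i x)%:R * f y))).
  by rewrite big_split /= -!mulr_sumr !delta /resample; ring.
by move=> y _; ring.
Qed.

Lemma heat_reversible : reversible p Q.
Proof.
apply: kernel_reversible => x y; rewrite /heat_fun !mulr_sumr; apply: eq_bigr => i _.
have [->//|xy] := eqVneq x y.
rewrite [x == _]flip_eq !mulr0 !add0r.
have [->|_] := eqVneq y (fl i x); last by rewrite !mulr0.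
rewrite /a flipK /gibbs -/(w _) -/(w _) [w (fl i x) + _]addrC.
by field; rewrite ?M_neq0 ?Z_neq0 ?ww_neq0.
Qed.

(** Each conditional expectation [E] is an orthogonal projection, so [<f, E f> = <E f, E f>];
    positive semidefiniteness of [Q] follows. *)
Lemma heat_form f : << vec f, Q *m vec f >> =
  M^-1 * \sum_i \sum_x pi x * (resample f i x) ^+ 2.
Proof.
rewrite heat_mul_vec ip_vec.
transitivity (M^-1 * \sum_i \sum_x pi x * (f x * resample f i x)).
  rewrite exchange_big [RHS]mulr_sumr; apply: eq_bigr => x _ /=.
  by rewrite -mulr_sumr -mulr_sumr; ring.
congr (_ * _); apply: eq_bigr => i _; apply: (eq_sum_pair (flipK (lift ord0 i))) => x.
rewrite /resample flipK resample_prob_flip !gibbsE /a.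
by field; rewrite ww_neq0.
Qed.

Lemma heat_psd (v : 'cV_#|{: config m}|) : 0 <= << v, Q *m v >>.
Proof.
rewrite (vecE v) heat_form mulr_ge0 ?invr_ge0 //.
by do 2![apply: sumr_ge0 => ? _]; rewrite mulr_ge0 ?sqr_ge0 // ltW // gibbs_gt0.
Qed.

(** Edge by edge [w w' / (w + w') <= min w w'], and the moves of the centre only add to the
    Metropolis side. The prefactors undo the site probabilities [1 / m] and [1 / (2 (m + 1))]. *)
Lemma heat_le_metropolis f : M * (<< vec f, vec f >> - << vec f, Q *m vec f >>) <=
  2 * m.+1%:R * (<< vec f, vec f >> - << vec f, P *m vec f >>).
Proof.
rewrite metropolis_dirichlet.
have -> : M * (<< vec f, vec f >> - << vec f, Q *m vec f >>) =
    (2 * Z)^-1 * \sum_i \sum_x (w x * w (fl i x) / (w x + w (fl i x))) * (f x - f (fl i x)) ^+ 2.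
  rewrite heat_form ip_vec mulrBr mulrA divff // mul1r.
  have -> : M * (\sum_x pi x * (f x * f x)) = \sum_(i < m) \sum_x pi x * (f x * f x).
    by rewrite sumr_const card_ord mulr_natl.
  rewrite -sumrB [RHS]mulr_sumr; apply: eq_bigr => i _.
  rewrite -sumrB [RHS]mulr_sumr; apply: (eq_sum_pair (flipK (lift ord0 i))) => x.
  rewrite /resample flipK resample_prob_flip !gibbsE /a [w (fl i x) + _]addrC.
  by field; rewrite ww_neq0.
have -> : 2 * m.+1%:R * ((4 * m.+1%:R * Z)^-1 *
    \sum_i \sum_x edge K beta x i * (f x - f (flip i x)) ^+ 2) =
    (2 * Z)^-1 * \sum_i \sum_x edge K beta x i * (f x - f (flip i x)) ^+ 2.
  by rewrite mulrA; congr (_ * _); field; rewrite Z_neq0 nat1r pnatr_eq0.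
apply: ler_wpM2l; first by rewrite invr_ge0 mulr_ge0 // ltW.
rewrite [leRHS]big_ord_recl /= -[leLHS]add0r; apply: lerD.
  by apply: sumr_ge0 => x _; rewrite mulr_ge0 ?sqr_ge0 // edge_ge0.
apply: ler_sum => i _; apply: ler_sum => x _; apply: ler_wpM2r; first exact: sqr_ge0.
have w1 := w_gt0 x; have w2 := w_gt0 (fl i x).
rewrite /edge le_min !ler_pdivrMr ?addr_gt0 //.
by apply/andP; split; nra.
Qed.

Definition outer_lip (l : R) f := forall x i, `|f x - f (fl i x)| <= l.

Definition even f := forall x, f (negc x) = f x.

(** The probability is a logistic function of [2 beta s_j (s_0 + h_j)], with [h_j] the local field.
    Flipping spin [i] shifts this argument by [4 beta |K j i|] in absolute value, and [kappa <= 1/2]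
    keeps it on one side of 0 at distance at least [beta], where the slope is at most
    [1 / (4 beta)]. *)
Lemma resample_prob_lip x i j : i != j -> `|a x j - a (fl i x) j| <= `|K j i|.
Proof.
move=> ij.
have aE y : a y j = (1 + expR (2 * beta * (spin y (lift ord0 j) * (spin y ord0 + local_field K y j))))^-1.
  rewrite /a; have -> : w y = w (fl j y) * expR (2 * beta * (spin y (lift ord0 j) * (spin y ord0 + local_field K y j))).
    by rewrite /weight -expRD hamiltonian_flip //; congr expR; ring.
  by field; rewrite !gt_eqF ?addr_gt0 ?mulr_gt0 ?expR_gt0 //.
rewrite !aE spin_flip (inj_eq lift_inj) eq_sym (negbTE ij) spin_flip /= local_field_flip //.
have l1 := local_field_le Kdiag x j; have l2 := local_field_le Kdiag (fl i x) j.
rewrite local_field_flip // in l2.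
set A := local_field K x j in l1 l2 *.
have {l1 l2} : [/\ - (1 / 2) <= A, A <= 1 / 2, - (1 / 2) <= A - 2 * K j i * spin x (lift ord0 i)
    & A - 2 * K j i * spin x (lift ord0 i) <= 1 / 2].
  have hk := hkappa; move: l1 l2; rewrite !ler_norml => /andP[? ?] /andP[? ?]; split; lra.
have : `|K j i * spin x (lift ord0 i)| = `|K j i| by rewrite normrM normr_spin mulr1.
rewrite -[2 * K j i * _]mulrA.
move: (K j i * spin x (lift ord0 i)) => e <- [A1 A2 B1 B2].
(* The slope bound is void at [beta = 0], where all probabilities are [1/2]. *)
have [b0|b_neq0] := eqVneq beta 0.
  by rewrite b0 !mulr0 !mul0r subrr normr0.
have b_gt0 : 0 < beta by rewrite lt_def b_neq0.
pose sg (v : R) := (1 + expR v)^-1.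
have sgN v : sg (- v) = 1 - sg v.
  by rewrite /sg expRN; field; rewrite !gt_eqF ?addr_gt0 ?expR_gt0.
have lip u v : beta <= u -> beta <= v -> 4 * beta * `|sg u - sg v| <= `|u - v|.
  move=> bu bv; wlog uv : u v bu bv / u <= v.
    move=> h; have [/h->//|/ltW vu] := leP u v.
    by rewrite distrC [leRHS]distrC h.
  have := logistic_lipschitz bu uv; rewrite -/(sg u) -/(sg v) => l.
  have sguv : sg v <= sg u by rewrite /sg lef_pV2 ?posrE ?addr_gt0 ?expR_gt0 // lerD2l ler_expR.
  by rewrite ger0_norm ?subr_ge0 // distrC ger0_norm ?subr_ge0.
have lip2 u v : (beta <= u /\ beta <= v) \/ (beta <= - u /\ beta <= - v) ->
    4 * beta * `|sg u - sg v| <= `|u - v|.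
  case=> [[]|[bu bv]]; first exact: lip.
  have := lip _ _ bu bv; rewrite !sgN.
  have -> : 1 - sg u - (1 - sg v) = - (sg u - sg v) by ring.
  by rewrite normrN -opprD normrN.
rewrite -/(sg _) -/(sg _) -(@ler_pM2l _ (4 * beta)) ?mulr_gt0 //.
set u := 2 * beta * _; set v := 2 * beta * _.
apply: le_trans (lip2 u v _) _.
  rewrite /u /v /spin; case: (x _); case: (x _); rewrite ?mul1r ?mulN1r.
  - by left; split; nra.
  - by right; split; nra.
  - by right; split; nra.
  - by left; split; nra.
have -> : u - v = spin x (lift ord0 j) * (4 * beta * e) by rewrite /u /v; ring.
by rewrite normrM normr_spin mul1r normrM [`|4 * beta|]ger0_norm // mulr_ge0.
Qed.

(** Path coupling: resampling the site [i] itself erases the discrepancy. At another site [j],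
    coupled updates keep it, at cost [l], and disagree with probability at most [|K j i|]. *)
Lemma resample_lip l f i j : 0 <= l -> outer_lip l f -> forall x,
  `|resample f j x - resample f j (fl i x)| <= (j != i)%:R * l + `|K j i| * l.
Proof.
move=> l_ge0 fl_lip x; have [->|ji] := eqVneq j i.
  rewrite /resample flipK resample_prob_flip Kdiag.
  have -> : f x + a x i * (f (fl i x) - f x) -
    (f (fl i x) + (1 - a x i) * (f x - f (fl i x))) = 0 by ring.
  by rewrite !normr0 !mul0r addr0.
rewrite mul1r /resample [fl j (fl i x)]flipC.
set y := fl i x; set x' := fl j x; set y' := flip (lift ord0 i) x'.
have -> : f x + a x j * (f x' - f x) - (f y + a y j * (f y' - f y)) =
  (1 - a x j) * (f x - f y) + a x j * (f x' - f y') + (a x j - a y j) * (f y' - f y) by ring.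
have a0 := resample_prob_ge0 x j; have a1 := resample_prob_le1 x j.
have aa : `|a x j - a y j| <= `|K j i| by apply: resample_prob_lip; rewrite eq_sym.
move: (a x j) (a y j) a0 a1 aa => b b' a0 a1 aa.
apply: (le_trans (ler_normD _ _)); apply: lerD.
  apply: (le_trans (ler_normD _ _)).
  rewrite !normrM (ger0_norm a0) (ger0_norm (_ : 0 <= 1 - b)) ?subr_ge0 //.
  have := fl_lip x i; have := fl_lip x' i; rewrite -/y -/y' => h1 h2.
  have : b * `|f x' - f y'| <= b * l by rewrite ler_wpM2l.
  have : (1 - b) * `|f x - f y| <= (1 - b) * l by rewrite ler_wpM2l ?subr_ge0.
  lra.
rewrite normrM; apply: ler_pM => //.
by rewrite distrC; have := fl_lip y j; rewrite /y flipC -/x' -/y'.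
Qed.

(** This is [1 - (1 - k) / M]: one site out of [m] erases a discrepancy, and the others spread it
    with total influence at most [k]. *)
Definition contraction_factor : R := (M - 1 + k) / M.
Local Notation rho := contraction_factor.

Lemma heat_lip l f : 0 <= l -> outer_lip l f ->
  outer_lip (rho * l) (fun x => M^-1 * \sum_i resample f i x).
Proof.
move=> l_ge0 f_lip x i.
rewrite -mulrBr normrM ger0_norm ?invr_ge0 // /rho [_ / M]mulrC -mulrA.
apply: ler_wpM2l; first by rewrite invr_ge0.
rewrite -sumrB; apply: (le_trans (ler_norm_sum _ _ _)).
apply: (@le_trans _ _ (\sum_j ((j != i)%:R * l + `|K j i| * l))).
  by apply: ler_sum => j _; exact: resample_lip.
rewrite big_split /= -!mulr_suml -mulrDl; apply: ler_wpM2r => //; apply: lerD.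
  have -> : \sum_(j < m) (j != i)%:R = M - 1 :> R.
    rewrite (bigD1 i) //= eqxx add0r.
    rewrite (eq_bigr (fun=> 1)) => [|j ->//]; rewrite sumr_const.
    have -> : #|(fun j : 'I_m => j != i)| = m.-1.
      by have := cardC1 i; rewrite card_ord => <-.
    by rewrite -[m in RHS](prednK m_gt0) -natr1 addrK.
  exact: lexx.
apply: le_trans (sum_normK_le_kappa Kdiag i).
by apply: ler_sum => j _; rewrite (K_sym Ksym).
Qed.

Lemma heat_even f : even f -> even (fun x => M^-1 * \sum_i resample f i x).
Proof.
move=> f_even x; congr (_ * _); apply: eq_bigr => i _.
by rewrite /resample resample_prob_negc flip_negc !f_even.
Qed.

(** Evenness allows replacing [y] by [negc y] when the centres differ; only outer spins, at most [m]
    of them, are then left to change. *)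
Lemma even_lip_bound l f : 0 <= l -> even f -> outer_lip l f -> forall x y, `|f x - f y| <= M * l.
Proof.
move=> l_ge0 f_even f_lip x y.
wlog xy : y / x ord0 = y ord0.
  move=> h; have [/h//|/eqP xy] := eqVneq (x ord0) (y ord0).
  rewrite -(f_even y); apply: h; rewrite ffunE; move: xy.
  by case: (x ord0); case: (y ord0).
(* An interpolating path: the first [t] outer spins of [y], the other spins of [x]. *)
pose z (t : nat) : config m :=
  [ffun j => if unlift ord0 j is Some i then (if (i < t)%N then y j else x j) else x j].
have zx : z 0%N = x.
  by apply/ffunP => j; rewrite ffunE; case: unliftP => [i _|_].
have zy : z m = y.
  apply/ffunP => j; rewrite ffunE; case: unliftP => [i _|->]; last exact: xy.
  by rewrite ltn_ord.
have step (i : 'I_m) : z i.+1 = z i \/ z i.+1 = fl i (z i).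
  have [e|ne] := eqVneq (x (lift ord0 i)) (y (lift ord0 i)).
    left; apply/ffunP => j; rewrite !ffunE; case: unliftP => [i' ->|//].
    rewrite ltnS leq_eqVlt; case: (eqVneq (i' : nat) i) => //= ii.
    have -> : i' = i by apply: val_inj.
    by rewrite ltnn e.
  right; apply/ffunP => j; rewrite !ffunE; case: unliftP => [i' ->|->] /=.
    rewrite (inj_eq lift_inj) ltnS leq_eqVlt -val_eqE /=.
    case: (eqVneq (i' : nat) i) => //= ii.
    have -> : i' = i by apply: val_inj.
    by rewrite ltnn; move: ne; case: (x _); case: (y _).
  by [].
have : forall t : nat, (t <= m)%N -> `|f x - f (z t)| <= t%:R * l.
  elim=> [|t IHt] tm; first by rewrite zx subrr normr0 mul0r.
  have -> : f x - f (z t.+1) = (f x - f (z t)) + (f (z t) - f (z t.+1)) by ring.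
  apply: (le_trans (ler_normD _ _)); rewrite -natr1 mulrDl mul1r; apply: lerD.
    by apply: IHt; apply: ltnW.
  by case: (step (Ordinal tm)) => /= ->; rewrite ?subrr ?normr0 // f_lip.
by move=> /(_ m (leqnn m)); rewrite zy.
Qed.

Lemma heat_iter_even t f l : 0 <= l -> even f -> outer_lip l f ->
  exists2 g, Q ^+ t *m vec f = vec g & even g /\ outer_lip (rho ^+ t * l) g.
Proof.
move=> l_ge0 f_even f_lip; have rho_ge0 : 0 <= rho.
  rewrite divr_ge0 // addr_ge0 ?kappa_ge0 // subr_ge0 ler1n //.
elim: t => [|t [g Eg [g_even g_lip]]].
  by exists f; rewrite ?expr0 ?mul1mx // mul1r.
exists (fun x => M^-1 * \sum_i resample g i x).
  by rewrite exprS -mulmxE -mulmxA Eg heat_mul_vec.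
split; first exact: heat_even.
by rewrite exprS -mulrA; apply: heat_lip => //; rewrite mulr_ge0 ?exprn_ge0.
Qed.

Lemma gibbs_index_gt0 i : 0 < p i. Proof. exact: gibbs_gt0. Qed.

(** Lipschitz contraction gives [<f, Q^t f> <= C rho^t], whereas [psd_power_ge] bounds it below by
    [<f, f>] times the [t]-th power of the Rayleigh quotient; comparing rates removes [C]. *)
Lemma heat_spectral_bound f : (1 < m)%N -> even f -> << vec f, const_mx 1 >> = 0 ->
  << vec f, Q *m vec f >> <= rho * << vec f, vec f >>.
Proof.
move=> m_gt1 f_even f_one.
have rho_gt0 : 0 < rho.
  rewrite divr_gt0 // ltr_wpDr ?kappa_ge0 // subr_gt0 ltr1n //.
have [f0|f_neq0] := eqVneq (vec f) 0.
  rewrite f0 mulmx0.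
  have -> : << 0, 0 >> = 0 by rewrite /ip big1 // => i _; rewrite mxE !mulr0.
  by rewrite mulr0.
have ff_gt0 := ip_gt0 gibbs_index_gt0 f_neq0.
(* A crude Lipschitz constant, which only enters [C]. *)
pose l := \sum_x \sum_i `|f x - f (fl i x)|.
have l_ge0 : 0 <= l by do 2![apply: sumr_ge0 => ? _].
have f_lip : outer_lip l f.
  move=> x i; rewrite /l (bigD1 x) //= (bigD1 i) //= -addrA lerDl addr_ge0 //.
    exact: sumr_ge0.
  by do 2![apply: sumr_ge0 => ? _].
pose F := \sum_x pi x * `|f x|.
have bound t : << vec f, Q ^+ t *m vec f >> <= F * (M * l) * rho ^+ t.
  have [g -> [g_even g_lip]] := heat_iter_even t l_ge0 f_even f_lip.
  (* An arbitrary reference point: as [f] has mean zero, [g y] can be subtracted from [g], and the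
     oscillation of [g] suffices. *)
  pose y : config m := [ffun=> true].
  have -> : << vec f, vec g >> = \sum_x pi x * (f x * (g x - g y)).
    rewrite ip_vec -[LHS]subr0 -[X in _ - X = _](mul0r (g y)) -[X in _ - X * _]f_one.
    rewrite vec1 ip_vec mulr_suml -sumrB; apply: eq_bigr => x _; ring.
  rewrite -!mulrA mulr_suml; apply: ler_sum => x _; rewrite -mulrA.
  rewrite ler_wpM2l ?(ltW (gibbs_gt0 _ _ _)) //.
  apply: (le_trans (ler_norm _)); rewrite normrM; apply: ler_wpM2l => //.
  apply: le_trans (even_lip_bound _ g_even g_lip x y) _.
    by rewrite mulr_ge0 // exprn_ge0 // ltW.
  by rewrite [l * _]mulrC.
rewrite -ler_pdivrMr //.
apply: (@geometric_dominated _ _ _ (F * (M * l) / << vec f, vec f >>)) => //.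
  by rewrite divr_ge0 ?heat_psd // ltW.
move=> t; rewrite expr_div_n ler_pdivrMr ?exprn_gt0 //.
rewrite -(@ler_pM2r _ << vec f, vec f >>) //.
apply: le_trans (psd_power_ge gibbs_index_gt0 heat_reversible heat_psd (vec f) t) _.
apply: (@le_trans _ _ (F * (M * l) * rho ^+ t * << vec f, vec f >> ^+ t)).
  by rewrite ler_wpM2r ?exprn_ge0 ?(ltW ff_gt0).
by rewrite le_eqVlt; apply/orP; left; apply/eqP; field; rewrite gt_eqF.
Qed.

Lemma even_poincare f : (1 < m)%N -> even f -> << vec f, const_mx 1 >> = 0 ->
  (1 - k) / (2 * m.+1%:R) * << vec f, vec f >> <= << vec f, vec f >> - << vec f, P *m vec f >>.
Proof.
move=> m_gt1 f_even f_one.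
have h1 := heat_spectral_bound m_gt1 f_even f_one.
have h2 := heat_le_metropolis f.
rewrite mulrAC ler_pdivrMr ?mulr_gt0 // [leRHS]mulrC; apply: le_trans h2.
have -> : (1 - k) * << vec f, vec f >> = M * (<< vec f, vec f >> - rho * << vec f, vec f >>).
  by rewrite /rho; field.
by apply: ler_wpM2l => //; rewrite lerD2l lerN2.
Qed.

End HeatBath.

(** * Orbits *)

Section PositiveGap.
Context {R : realType} {n : nat} (p : 'I_n -> R) (M : 'M[R]_n).
Hypotheses (n_gt1 : (1 < n)%N) (p_gt0 : forall i, 0 < p i).
Hypotheses (Mrev : reversible p M) (Mone : M *m const_mx 1 = const_mx 1 :> 'cV_n).
Hypothesis Mcontr : forall f, ip p f (M *m f) <= ip p f f.

Lemma gap_ge0 : 0 <= gap M.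
Proof.
apply: (le_gap n_gt1 p_gt0 Mrev) => f _.
by rewrite mul0r subr_ge0.
Qed.

(** Test the gap on a mean-zero combination of two point masses. The bound later absorbs odd
    functions, which orbit averaging kills. *)
Lemma gap_le1 : (forall f, 0 <= ip p f (M *m f)) -> gap M <= 1.
Proof.
move=> Mpsd; pose i : 'I_n := Ordinal (ltnW n_gt1); pose j : 'I_n := Ordinal n_gt1.
pose f : 'cV[R]_n := p j *: delta_mx i 0 - p i *: delta_mx j 0.
have f_neq0 : f != 0.
  apply/eqP => /matrixP/(_ i 0); rewrite !mxE !eqxx /= mulr1 mulr0 subr0 => /eqP.
  by rewrite gt_eqF.
have ip_delta l (g : 'cV[R]_n) : ip p (delta_mx l 0) g = p l * g l 0.
  rewrite /ip (bigD1 l) //= big1 => [|l' ll]; first by rewrite mxE !eqxx mul1r addr0.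
  by rewrite mxE (negbTE ll) mul0r mulr0.
have f_one : ip p f (const_mx 1) = 0.
  by rewrite ipC ipBr !ipZr ![ip _ (const_mx 1) _]ipC !ip_delta !mxE; ring.
have ff := ip_gt0 p_gt0 f_neq0.
have h := gap_poincare n_gt1 p_gt0 Mrev Mone Mcontr f_one.
have h0 := Mpsd f; rewrite -(ler_pM2r ff) mul1r; lra.
Qed.

End PositiveGap.

Section Orbits.
Context {R : realType} {m : nat}.
Implicit Types (x y : config m).

Lemma orbit_mem x : [set x; negc x] \in orbits m.
Proof. by apply/imsetP; exists x. Qed.

Definition orbit_of x : orbit_space m := exist _ [set x; negc x] (orbit_mem x).

Lemma orbit_of_eq (O : orbit_space m) x : (x \in val O) = (orbit_of x == O).
Proof.
apply/idP/eqP => [|<-]; last by rewrite /= !inE eqxx.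
case: O => O Oorb /= xO; apply: val_inj => /=.
have /imsetP[y _ Oy] := Oorb; move: xO; rewrite Oy !inE.
by case/orP => /eqP ->; rewrite ?negcK // finset.setUC.
Qed.

Lemma sum_orbits (F : config m -> R) :
  \sum_(O : orbit_space m) \sum_(x in val O) F x = \sum_x F x.
Proof.
rewrite [RHS](partition_big orbit_of predT) //=; apply: eq_bigr => O _.
by apply: eq_bigl => x; rewrite orbit_of_eq.
Qed.

Lemma sum_orbits_lift (F : config m -> R) (phi : orbit_space m -> R) :
  \sum_(O : orbit_space m) \sum_(x in val O) F x * phi O = \sum_x F x * phi (orbit_of x).
Proof.
rewrite -sum_orbits; apply: eq_bigr => O _; apply: eq_bigr => x.
by rewrite orbit_of_eq => /eqP ->.
Qed.

Lemma orbit_of_negc x : orbit_of (negc x) = orbit_of x.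
Proof. by apply: val_inj; rewrite /= negcK finset.setUC. Qed.

(** The value at an arbitrary representative, independent of the choice for even [f]; orbits are
    nonempty, so the default [0] is never reached. *)
Definition even_lift (f : config m -> R) (O : orbit_space m) : R :=
  if [pick x in val O] is Some x then f x else 0.

Lemma even_liftE f x : even f -> even_lift f (orbit_of x) = f x.
Proof.
move=> f_even; rewrite /even_lift; case: pickP => [y|/(_ x)].
  by rewrite /= !inE => /orP[] /eqP -> //; rewrite f_even.
by rewrite /= !inE eqxx.
Qed.

Lemma card_orbits : (0 < m)%N -> (1 < #|{: orbit_space m}|)%N.
Proof.
move=> m_gt0; pose x : config m := [ffun=> true].
have : orbit_of x != orbit_of (flip ord0 x).
  apply/eqP => /(congr1 val) /= /setP /(_ x); rewrite !inE eqxx /= => /esym.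
  rewrite eq_sym flip_neq /= => /eqP/ffunP/(_ (lift ord0 (Ordinal m_gt0))).
  by rewrite !ffunE.
rewrite ltnNge; apply: contra_neqN => /card_le1_eqP h; exact: h.
Qed.

Lemma card_configs : (1 < #|{: config m}|)%N.
Proof. by rewrite card_ffun card_bool card_ord (@leq_exp2l 2 1). Qed.

End Orbits.

(** * The projection chain as the even part of the dynamics *)

Section Projection.
Context {R : realType} {m : nat} (K : 'M[R]_m) (beta : R).
Hypotheses (Ksym : K^T = K) (Kdiag : forall i, K i i = 0).
Implicit Types (x y : config m) (O : orbit_space m) (phi psi : orbit_space m -> R).
Local Notation pi := (gibbs K beta).
Local Notation P := (metropolis K beta).
Local Notation Pbar := (projected K beta).
Local Notation pfun := (metropolis_fun K beta).

Definition orbit_gibbs O : R := \sum_(x in val O) pi x.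
Local Notation pib := orbit_gibbs.

Lemma orbit_gibbs_gt0 O : 0 < pib O.
Proof.
case: O => O Oorb; have /imsetP[y _ Oy] := Oorb.
rewrite /pib /= (bigD1 y) /= ?Oy ?inE ?eqxx //.
by rewrite ltr_pwDl ?gibbs_gt0 // sumr_ge0 // => x _; rewrite ltW // gibbs_gt0.
Qed.

Lemma orbit_ip phi psi :
  ip (on_index pib) (vec phi) (vec psi) =
  ip (on_index pi) (vec (phi \o orbit_of)) (vec (psi \o orbit_of)).
Proof.
rewrite !ip_vec -(sum_orbits_lift _ (fun O => phi O * psi O)).
by apply: eq_bigr => O _; rewrite mulr_suml.
Qed.

Lemma projected_balance O O' :
  pib O * projected_fun K beta O O' = pib O' * projected_fun K beta O' O.
Proof.
rewrite /projected_fun !mulrA !mulr1 !mulfV ?gt_eqF ?orbit_gibbs_gt0 // !mul1r.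
rewrite exchange_big; apply: eq_bigr => y _; apply: eq_bigr => x _.
exact: metropolis_balance.
Qed.

Lemma projected_reversible : reversible (on_index pib) Pbar.
Proof. by apply: kernel_reversible; exact: projected_balance. Qed.

(** The projection chain is [P] on even functions: composition with [orbit_of], an isometry by
    [orbit_ip], also preserves the form of the kernel. *)
Lemma projected_form phi psi :
  ip (on_index pib) (vec phi) (Pbar *m vec psi) =
  ip (on_index pi) (vec (phi \o orbit_of)) (P *m vec (psi \o orbit_of)).
Proof.
rewrite !kernel_mul_vec !ip_vec.
transitivity (\sum_x (pi x * \sum_y pfun x y * psi (orbit_of y)) * phi (orbit_of x)); last first.
  by apply: eq_bigr => x _ /=; ring.
rewrite -sum_orbits_lift; apply: eq_bigr => O _.
rewrite -mulr_suml mulrCA mulrC; congr (_ * _).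
transitivity (\sum_(O' : orbit_space m) (\sum_(x in val O) \sum_(y in val O') pi x * pfun x y) * psi O').
  rewrite mulr_sumr; apply: eq_bigr => O' _; rewrite /projected_fun !mulrA mulr1.
  by rewrite mulfV ?mul1r // gt_eqF // orbit_gibbs_gt0.
transitivity (\sum_(x in val O) \sum_(O' : orbit_space m) \sum_(y in val O') pi x * pfun x y * psi O').
  rewrite [RHS]exchange_big; apply: eq_bigr => O' _; rewrite mulr_suml.
  by apply: eq_bigr => x _; rewrite mulr_suml.
apply: eq_bigr => x _; rewrite sum_orbits_lift mulr_sumr.
by apply: eq_bigr => y _; rewrite mulrA.
Qed.

Lemma projected_one : Pbar *m const_mx 1 = const_mx 1 :> 'cV_#|{: orbit_space m}|.
Proof.
rewrite vec1 kernel_mul_vec; apply: eq_vec => O.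
have piO := orbit_gibbs_gt0 O.
apply: (mulfI (lt0r_neq0 piO)); rewrite mulr1 mulr_sumr.
transitivity (\sum_(O' : orbit_space m) \sum_(x in val O) \sum_(y in val O') pi x * pfun x y).
  apply: eq_bigr => O' _; rewrite /projected_fun mulr1 !mulrA mulr1.
  by rewrite mulfV ?mul1r // gt_eqF.
rewrite exchange_big; apply: eq_bigr => x _ /=.
rewrite sum_orbits -mulr_sumr.
have := metropolis_fun_apply K beta (fun=> 1) x.
rewrite (eq_bigr _ (fun i _ => mulr1 _)) => ->.
by rewrite big1 ?addr0 ?mulr1 // => i _; rewrite subrr mulr0.
Qed.

Lemma projected_contracts (v : 'cV_#|{: orbit_space m}|) :
  ip (on_index pib) v (Pbar *m v) <= ip (on_index pib) v v.
Proof. by rewrite (vecE v) projected_form orbit_ip metropolis_contracts. Qed.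

Lemma projected_psd (v : 'cV_#|{: orbit_space m}|) : 0 <= ip (on_index pib) v (Pbar *m v).
Proof. by rewrite (vecE v) projected_form metropolis_psd. Qed.

Lemma orbit_p_gt0 i : 0 < on_index pib i. Proof. exact: orbit_gibbs_gt0. Qed.

Lemma projected_gap_le1 : (0 < m)%N -> gap Pbar <= 1.
Proof.
move=> m_gt0; apply: (gap_le1 (card_orbits m_gt0) orbit_p_gt0 projected_reversible).
- exact: projected_one.
- exact: projected_contracts.
- exact: projected_psd.
Qed.

Lemma projected_gap_ge0 : (0 < m)%N -> 0 <= gap Pbar.
Proof.
move=> m_gt0; apply: (gap_ge0 (card_orbits m_gt0) orbit_p_gt0 projected_reversible).
exact: projected_contracts.
Qed.

Lemma even_projected_poincare f : (0 < m)%N -> even f ->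
  ip (on_index pi) (vec f) (const_mx 1) = 0 ->
  gap Pbar * ip (on_index pi) (vec f) (vec f) <=
  ip (on_index pi) (vec f) (vec f) - ip (on_index pi) (vec f) (P *m vec f).
Proof.
move=> m_gt0 f_even f_one.
have fE : vec f = vec (even_lift f \o orbit_of).
  by apply: eq_vec => x; rewrite /= even_liftE.
rewrite fE -projected_form -orbit_ip.
apply: (gap_poincare (card_orbits m_gt0) orbit_p_gt0 projected_reversible).
- exact: projected_one.
- exact: projected_contracts.
by rewrite vec1 orbit_ip -fE -f_one vec1.
Qed.

Lemma projected_gap_ge : 0 <= beta -> kappa K <= 1 / 2 -> (1 < m)%N ->
  (1 - kappa K) / (2 * m.+1%:R) <= gap Pbar.
Proof.
move=> beta_ge0 hkappa m_gt1; have m_gt0 := ltnW m_gt1.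
apply: (le_gap (card_orbits m_gt0) orbit_p_gt0 projected_reversible) => v.
rewrite vec1 (vecE v) projected_form !orbit_ip => v_one.
apply: even_poincare => //; last by rewrite vec1.
by move=> x /=; rewrite orbit_of_negc.
Qed.

End Projection.

(** * Kernels averaged over orbits *)

Section OrbitAveraging.
Context {R : realType} {m : nat} (K : 'M[R]_m) (beta : R).
Hypotheses (Ksym : K^T = K) (Kdiag : forall i, K i i = 0) (m_gt0 : (0 < m)%N).
Implicit Types (x y : config m) (f : config m -> R) (v : 'cV[R]_#|{: config m}|).
Local Notation pi := (gibbs K beta).
Local Notation p := (on_index pi).
Local Notation P := (metropolis K beta).
Local Notation G := (orbit_avg R m).
Local Notation g := (gap (projected K beta)).
Local Notation "<< f , g >>" := (ip p f g).

Definition evenize f x : R := 2^-1 * (f x + f (negc x)).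

Lemma evenize_even f : even (evenize f).
Proof. by move=> x; rewrite /evenize negcK addrC. Qed.

Lemma orbit_avg_vec f : G *m vec f = vec (evenize f).
Proof.
rewrite /orbit_avg -scalemxAl mulmxDl mul1mx kernel_mul_vec.
apply/matrixP => i j; rewrite !mxE; congr (_ * (_ + _)).
rewrite (bigD1 (negc (enum_val i))) //= eqxx mul1r big1 ?addr0 //.
by move=> y /negbTE ->; rewrite mul0r.
Qed.

Lemma orbit_avg_one : G *m const_mx 1 = const_mx 1 :> 'cV_#|{: config m}|.
Proof.
by rewrite vec1 orbit_avg_vec; apply: eq_vec => x; rewrite /evenize; field.
Qed.

Lemma reversible_lin (A B : 'M[R]_#|{: config m}|) c : reversible p A -> reversible p B ->
  reversible p (c *: (A + B)).
Proof.
move=> rA rB i j; rewrite !mxE mulrCA mulrDr rA rB -mulrDr mulrCA //.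
Qed.

Lemma orbit_avg_reversible : reversible p G.
Proof.
apply: reversible_lin; first exact: reversible1.
apply: kernel_reversible => x y; have -> : (y == negc x) = (x == negc y) by rewrite eq_sym (can2_eq (@negcK m) (@negcK m)).
have [->|_] := eqVneq x (negc y); last by rewrite !mulr0.
by rewrite gibbs_negc.
Qed.

Lemma orbit_avg_idem v : G *m (G *m v) = G *m v.
Proof.
rewrite (vecE v) !orbit_avg_vec; apply: eq_vec => x.
by rewrite {1}/evenize evenize_even; field.
Qed.

Lemma flip_rate_negc x i : flip_rate K beta (negc x) i = flip_rate K beta x i.
Proof. by rewrite /flip_rate flip_negc !hamiltonian_negc. Qed.

Lemma orbit_avg_commute v : G *m (P *m v) = P *m (G *m v).
Proof.
rewrite (vecE v) orbit_avg_vec !metropolis_mul_vec orbit_avg_vec.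
apply: eq_vec => x; rewrite /evenize.
rewrite (eq_bigr _ (fun i _ => congr1 (fun r => r * _) (flip_rate_negc x i))).
rewrite addrACA -big_split mulrDr mulr_sumr; congr (_ + _).
by apply: eq_bigr => i _; rewrite flip_negc /=; ring.
Qed.

Lemma orbit_avg_form v : << v, G *m v >> = << G *m v, G *m v >>.
Proof. by rewrite -[in LHS]orbit_avg_idem ip_adjoint //; exact: orbit_avg_reversible. Qed.

Lemma orbit_avg_contracts v : << G *m v, G *m v >> <= << v, v >>.
Proof.
have := orbit_avg_form v; set e := G *m v => ve.
have := ip_ge0 (gibbs_index_gt0 K beta) (v - e).
rewrite ipBr ![<< v - e, _ >>]ipC !ipBr [<< e, v >>]ipC ve; lra.
Qed.

Lemma orbit_avg_even v : exists2 f, G *m v = vec f & even f.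
Proof.
by exists (evenize (fun x => v (enum_rank x) 0));
  [rewrite {1}(vecE v) orbit_avg_vec | exact: evenize_even].
Qed.

Lemma orbit_avg_orthogonal v : << v, const_mx 1 >> = 0 -> << G *m v, const_mx 1 >> = 0.
Proof.
by move=> v1; rewrite -ip_adjoint ?orbit_avg_one //; exact: orbit_avg_reversible.
Qed.

Lemma orbit_avg_poincare v : << v, const_mx 1 >> = 0 ->
  g * << G *m v, G *m v >> <= << G *m v, G *m v >> - << G *m v, P *m (G *m v) >>.
Proof.
move=> /orbit_avg_orthogonal; have [f -> f_even] := orbit_avg_even v.
exact: even_projected_poincare.
Qed.

Local Notation GPG := (G *m P *m G).
Local Notation PG2 := (2^-1 *: (P + G)).

Lemma GPG_form v : << v, GPG *m v >> = << G *m v, P *m (G *m v) >>.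
Proof. by rewrite -!mulmxA ip_adjoint //; exact: orbit_avg_reversible. Qed.

Lemma GPG_psd v : 0 <= << v, GPG *m v >>.
Proof. by rewrite GPG_form metropolis_psd. Qed.

Lemma GPG_one : GPG *m const_mx 1 = const_mx 1 :> 'cV_#|{: config m}|.
Proof. by rewrite -!mulmxA !(orbit_avg_one, metropolis_one). Qed.

Lemma GPG_reversible : reversible p GPG.
Proof.
(* Matrix identities are read off column by column, from the action on basis vectors. *)
have comm : G *m P = P *m G.
  apply/matrixP => i j.
  have := orbit_avg_commute (delta_mx j 0); rewrite !mulmxA -!colE.
  by move=> /matrixP/(_ i 0); rewrite !mxE.
have -> : GPG = P *m G.
  rewrite comm -mulmxA; congr (_ *m _); apply/matrixP => i j.
  have := orbit_avg_idem (delta_mx j 0); rewrite !mulmxA -!colE.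
  by move=> /matrixP/(_ i 0); rewrite !mxE.
move=> i j; rewrite -{1}comm !mxE !mulr_sumr; apply: eq_bigr => l _.
rewrite mulrA orbit_avg_reversible mulrAC metropolis_reversible; ring.
Qed.

(** The even part of [v] obeys the inequality of the projection chain. The odd part is killed, so
    its full norm stays on the right, and [g <= 1] suffices for it. *)
Lemma GPG_poincare v : << v, const_mx 1 >> = 0 ->
  g * << v, v >> <= << v, v >> - << v, GPG *m v >>.
Proof.
move=> v1; rewrite GPG_form.
have := orbit_avg_poincare v1; have := orbit_avg_contracts v.
have := projected_gap_le1 K beta m_gt0; nra.
Qed.

Lemma PG2_form v : << v, PG2 *m v >> = 2^-1 * (<< v, P *m v >> + << G *m v, G *m v >>).
Proof. by rewrite -scalemxAl mulmxDl ipZr ipDr orbit_avg_form. Qed.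

Lemma PG2_psd v : 0 <= << v, PG2 *m v >>.
Proof.
by rewrite PG2_form mulr_ge0 // addr_ge0 ?metropolis_psd // ip_ge0 //; exact: gibbs_index_gt0.
Qed.

Lemma PG2_one : PG2 *m const_mx 1 = const_mx 1 :> 'cV_#|{: config m}|.
Proof.
rewrite -scalemxAl mulmxDl orbit_avg_one metropolis_one.
by apply/matrixP => i j; rewrite !mxE; field.
Qed.

Lemma PG2_reversible : reversible p PG2.
Proof.
by apply: reversible_lin; [exact: metropolis_reversible | exact: orbit_avg_reversible].
Qed.

(** Both [P] and [G] respect the splitting into even [e] and odd [o]. On [e] the averaging does
    nothing and half of the Dirichlet form of [P] remains; on [o] it gives half of the norm, and
    [g <= 1]. *)
Lemma PG2_poincare v : << v, const_mx 1 >> = 0 ->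
  g / 2 * << v, v >> <= << v, v >> - << v, PG2 *m v >>.
Proof.
move=> v1; rewrite PG2_form.
pose e := G *m v; pose o := v - e.
have vE : v = e + o by rewrite addrC subrK.
have Go : G *m o = 0 by rewrite mulmxBr orbit_avg_idem subrr.
have ort (u : 'cV_#|{: config m}|) : << G *m u, o >> = 0.
  rewrite -ip_adjoint; last exact: orbit_avg_reversible.
  by rewrite Go -(scale0r (0 : 'cV_#|{: config m}|)) ipZr mul0r.
have eo : << e, o >> = 0 := ort v.
have ePo : << o, P *m e >> = 0.
  by rewrite ipC /e -orbit_avg_commute ort.
clearbody o.
have Pform : << v, P *m v >> = << e, P *m e >> + << o, P *m o >>.
  rewrite vE mulmxDr !ipDl !ipDr ePo.
  rewrite [<< e, P *m o >>]ip_adjoint ?[<< P *m e, o >>]ipC ?ePo; first by ring.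
  exact: metropolis_reversible.
have vv : << v, v >> = << e, e >> + << o, o >>.
  by rewrite vE !ipDl !ipDr eo [<< o, e >>]ipC eo; ring.
rewrite -/e Pform vv.
have := orbit_avg_poincare v1; rewrite -/e.
have := metropolis_contracts K beta o; have := ip_ge0 (gibbs_index_gt0 K beta) o.
have := projected_gap_le1 K beta m_gt0; nra.
Qed.

End OrbitAveraging.

(** * The bounds *)

Section Bottleneck.
Context {R : realType} {m : nat} (K : 'M[R]_m) (beta : R).
Hypotheses (Ksym : K^T = K) (Kdiag : forall i, K i i = 0).
Hypotheses (beta_ge0 : 0 <= beta) (hkappa : kappa K <= 1 / 2).
Local Notation pi := (gibbs K beta).
Local Notation p := (on_index pi).
Local Notation P := (metropolis K beta).
Local Notation D := (m.+1%:R : R).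
Local Notation k := (kappa K).
Local Notation c := (cosh (beta * (1 - k))).
Local Notation "<< f , g >>" := (ip p f g).

Definition center_spin : 'cV[R]_#|{: config m}| := vec (fun x => spin x ord0).
Local Notation f := center_spin.

Lemma center_spin_one : << f, const_mx 1 >> = 0.
Proof.
rewrite vec1 ip_vec (sum_pair _ (@negcK m)) big1 ?mulr0 // => x _.
by rewrite gibbs_negc // spin_negc; ring.
Qed.

Lemma center_spin_norm : << f, f >> = 1.
Proof.
by rewrite ip_vec -[RHS](gibbs_sum K beta); apply: eq_bigr => x _; rewrite spin_sqr mulr1.
Qed.

Lemma center_spin_le1 i : `|f i 0| <= 1.
Proof. by rewrite mxE normr_spin. Qed.

Lemma cosh_ge1 (y : R) : 1 <= cosh y.
Proof. by rewrite /cosh; have := expR_ge1Dx y; have := expR_ge1Dx (- y); lra. Qed.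

(** Only moves of the centre change the test function, by 2 in absolute value; the square 4 cancels
    the 4 in the Dirichlet constant. *)
Lemma center_spin_dirichlet : 1 - << f, P *m f >> <= 1 / (D * c ^+ m).
Proof.
rewrite -[X in X - _ <= _]center_spin_norm metropolis_dirichlet.
have Z_gt0 := partition_fun_gt0 K beta.
have c_gt0 : 0 < c ^+ m by rewrite exprn_gt0 // (lt_le_trans ltr01) // cosh_ge1.
have -> : \sum_i \sum_x edge K beta x i * (spin x ord0 - spin (flip i x) ord0) ^+ 2 =
    4 * \sum_x edge K beta x ord0.
  rewrite (bigD1 ord0) //= [X in _ + X]big1 ?addr0 => [|i i0].
    rewrite mulr_sumr; apply: eq_bigr => x _; rewrite spin_flip eqxx opprK.
    have -> (u : R) : (u + u) ^+ 2 = 4 * (u * u) by ring.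
    by rewrite spin_sqr mulr1 mulrC.
  by rewrite big1 // => x _; rewrite spin_flip eq_sym (negbTE i0) subrr expr0n mulr0.
have kle1 : k <= 1 by have := hkappa; lra.
have := sum_min_weight_le Ksym Kdiag beta_ge0 kle1; rewrite -[\sum_x _]/(\sum_x edge K beta x ord0).
set S := \sum_x _ => hS.
have -> : (4 * D * partition_fun K beta)^-1 * (4 * S) = S / (D * partition_fun K beta).
  by field; rewrite gt_eqF //=.
rewrite ler_pdivrMr ?mulr_gt0 // mul1r mulrC ler_pdivlMr ?mulr_gt0 //.
have -> : S * (D * c ^+ m) = D * (c ^+ m * S) by ring.
by apply: ler_wpM2l.
Qed.

Lemma metropolis_gap_le : gap P <= 1 / (D * c ^+ m).
Proof.
apply: le_trans center_spin_dirichlet.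
have := gap_poincare (@card_configs m) (gibbs_index_gt0 K beta) (metropolis_reversible K beta)
  (metropolis_one K beta) (metropolis_contracts K beta) center_spin_one.
by rewrite center_spin_norm mulr1.
Qed.

Lemma metropolis_tmix_ge eps : (0 < m)%N -> 0 < eps ->
  (((D * c ^+ m - 1) * ln (1 / (2 * eps)))%:E <= tmix P pi eps)%E.
Proof.
move=> m_gt0 eps_gt0.
have Dc_gt1 : 1 < D * c ^+ m.
  apply: (@lt_le_trans _ _ D); first by rewrite ltr1n ltnS.
  by rewrite ler_peMr // exprn_ege1 // cosh_ge1.
have -> : D * c ^+ m = 1 / (1 / (D * c ^+ m)) by rewrite !div1r invrK.
apply: (tmix_ge (gibbs_gt0 K beta) (gibbs_sum K beta)
  (metropolis_reversible K beta) (metropolis_psd K beta) (f := f)) => //.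
- by rewrite div1r invr_gt0 invf_lt1 ?Dc_gt1 ?(lt_trans ltr01 Dc_gt1).
- exact: center_spin_le1.
- exact: center_spin_one.
- exact: center_spin_norm.
- exact: center_spin_dirichlet.
Qed.

(** With [q] the lower bound of [gibbs_lower], [A] is half the logarithm of [1 / ((2 eps)^2 q)]; so
    [1 - gm <= e^-gm] and [gm * t >= A] give the condition of [tv_distance_le]. *)
Lemma tmix_le_of_poincare (M : 'M[R]_#|{: config m}|) gm eps T :
  let A := ln (1 / (2 * eps)) + (D * ln 2 + beta * (2 + k) * (D - 1)) / 2 in
  0 < eps -> 0 <= gm <= 1 -> 0 <= T -> A <= gm * T ->
  reversible p M -> M *m const_mx 1 = const_mx 1 :> 'cV_#|{: config m}| ->
  (forall v, 0 <= << v, M *m v >>) ->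
  (forall v, << v, const_mx 1 >> = 0 -> gm * << v, v >> <= << v, v >> - << v, M *m v >>) ->
  (tmix M pi eps <= ((Num.ceil T)%:~R)%:E)%E.
Proof.
move=> A eps_gt0 /andP[gm_ge0 gm_le1] T_ge0 AT Mrev Mone Mpsd Mpoin.
have ceilT_ge0 : 0 <= Num.ceil T by rewrite ceil_ge0 (lt_le_trans _ T_ge0).
have [t Et] : exists t : nat, Num.ceil T = t%:Z.
  by exists `|Num.ceil T|%N; rewrite gez0_abs.
have Tt : T <= t%:R by have := ceil_ge T; rewrite Et.
rewrite Et; apply: tmix_le.
apply: (tv_distance_le (gibbs_gt0 K beta) (gibbs_sum K beta) Mrev Mone Mpsd (c := gm)) => //.
  exact: ltW.
move=> x.
apply: (@le_trans _ _ (expR (- gm) ^+ (2 * t))).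
  apply: lerXn2r; rewrite ?nnegrE ?subr_ge0 ?expR_ge0 //.
  by have := expR_ge1Dx (- gm).
apply: (@le_trans _ _ ((2 * eps) ^+ 2 *
    expR (- (D * ln 2 + beta * (2 + k) * m%:R)))); last first.
  by apply: ler_wpM2l; rewrite ?sqr_ge0 // gibbs_lower.
have eps2 : 0 < 2 * eps by rewrite mulr_gt0.
rewrite -[2 * eps]lnK ?posrE // -!expRM_natl -expRD ler_expR natrM.
have lnE : ln (1 / (2 * eps)) = - ln (2 * eps) by rewrite div1r lnV ?posrE.
have : A <= gm * t%:R by apply: le_trans AT _; apply: ler_wpM2l.
by rewrite /A lnE -(natr1 m) => h; lra.
Qed.

End Bottleneck.

(** * Assembly of the gap and mixing bounds *)

Unset Implicit Arguments.

Theorem theorem1p1 (R : realType) (d : nat) (hd : (3 <= d)%N)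
    (K : 'M[R]_(d.-1)) (Ksym : K^T = K) (Kdiag : forall i, K i i = 0)
    (hkappa : kappa K <= 1 / 2) (beta : R) (hbeta : 0 <= beta) :
  let P := metropolis K beta in
  let G := orbit_avg R d.-1 in
  let Pbar := projected K beta in
  let GPG := G *m P *m G in
  let PG2 := 2^-1 *: (P + G) in
  let pi := gibbs K beta in
  let k := kappa K in
  let D := d%:R : R in
  [/\ gap P <= 1 / (D * cosh (beta * (1 - k)) ^+ d.-1)
    /\ (forall eps : R, 0 < eps < 1 / 2 ->
         (((D * cosh (beta * (1 - k)) ^+ d.-1 - 1) * ln (1 / (2 * eps)))%:E
           <= tmix P pi eps)%E),
      [/\ gap GPG >= 1 / 4 * gap Pbar,
          1 / 4 * gap Pbar >= (1 - k) / (8 * D)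
        & (1 - k) / (8 * D) >= 1 / (16 * D)]
    /\ [/\ gap PG2 >= 1 / 8 * gap Pbar,
          1 / 8 * gap Pbar >= (1 - k) / (16 * D)
        & (1 - k) / (16 * D) >= 1 / (32 * D)]
    & forall eps : R, 0 < eps < 1 / 2 ->
      let A := ln (1 / (2 * eps))
               + (D * ln 2 + beta * (2 + k) * (D - 1)) / 2 in
      (tmix GPG pi eps <= ((Num.ceil (8 * D / (1 - k) * A))%:~R)%:E)%E
      /\ (tmix PG2 pi eps <= ((Num.ceil (16 * D / (1 - k) * A))%:~R)%:E)%E].
Proof.
case: d hd K Ksym Kdiag hkappa => [//|m] /=; rewrite ltnS => m_gt1 K Ksym Kdiag hkappa.
have m_gt0 : (0 < m)%N by apply: ltnW.
have D_gt0 : 0 < m.+1%:R :> R by [].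
have k_ge0 := kappa_ge0 K; have k1_gt0 : 0 < 1 - kappa K by lra.
have g_ge := projected_gap_ge Ksym Kdiag hbeta hkappa m_gt1.
have g_le1 := projected_gap_le1 K beta m_gt0.
have g_ge0 := projected_gap_ge0 K beta m_gt0.
(* The stated lower bounds are rewritten as multiples of [(1 - kappa) / (2 d)], the bound on the
   projected gap, and of [1 / (2 d)]. *)
have e8 : (1 - kappa K) / (8 * m.+1%:R) = 1 / 4 * ((1 - kappa K) / (2 * m.+1%:R)) by field.
have e16 : (1 - kappa K) / (16 * m.+1%:R) = 1 / 8 * ((1 - kappa K) / (2 * m.+1%:R)) by field.
have half : 1 / (2 * m.+1%:R) <= 2 * ((1 - kappa K) / (2 * m.+1%:R)).
  by rewrite mulrA; apply: ler_wpM2r; [rewrite invr_ge0 mulr_ge0 | lra].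
have f16 : 1 / (16 * m.+1%:R) = 1 / 8 * (1 / (2 * m.+1%:R)) :> R by field.
have f32 : 1 / (32 * m.+1%:R) = 1 / 16 * (1 / (2 * m.+1%:R)) :> R by field.
have lin (q h g : R) : q <= g -> h <= 2 * q ->
    [/\ 1 / 4 * q <= 1 / 4 * g, 1 / 8 * h <= 1 / 4 * q,
        1 / 8 * q <= 1 / 8 * g & 1 / 16 * h <= 1 / 8 * q].
  by move=> ? ?; split; lra.
have [l1 l2 l3 l4] := lin _ _ _ g_ge half.
have ip_ge0v := ip_ge0 (gibbs_index_gt0 K beta).
split.
- split; first exact: metropolis_gap_le.
  by move=> eps /andP[eps_gt0 _]; exact: metropolis_tmix_ge.
- rewrite e8 e16 f16 f32; split; split => //.
  (* The Poincaré constant is the projected gap itself, which exceeds the quarter asked for; below,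
     one half likewise replaces one eighth. *)
  + apply: (le_gap (@card_configs m) (gibbs_index_gt0 K beta) (GPG_reversible beta Ksym Kdiag)) => v v1.
    apply: le_trans (GPG_poincare Ksym Kdiag m_gt0 v1).
    by apply: ler_wpM2r; rewrite ?ip_ge0v //; lra.
  + apply: (le_gap (@card_configs m) (gibbs_index_gt0 K beta) (PG2_reversible beta Ksym Kdiag)) => v v1.
    apply: le_trans (PG2_poincare Ksym Kdiag m_gt0 v1).
    by apply: ler_wpM2r; rewrite ?ip_ge0v //; lra.
- move=> eps /andP[eps_gt0 eps_lt].
  set A := ln _ + _ / 2.
  have A_ge0 : 0 <= A.
    rewrite addr_ge0 //; first by rewrite ln_ge0 // ler_pdivlMr; lra.
    rewrite divr_ge0 // addr_ge0 ?mulr_ge0 ?ln_ge0 // ?subr_ge0 ?ler1n //; lra.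
  split.
  + apply: (@tmix_le_of_poincare _ _ _ _ Ksym Kdiag hbeta _ (gap (projected K beta))) => //.
    * by rewrite g_ge0.
    * by rewrite !mulr_ge0 // invr_ge0 ltW.
    (* The lower bound on the projected gap already makes the product [4 * A]. *)
    * apply: (@le_trans _ _ ((1 - kappa K) / (2 * m.+1%:R) * (8 * m.+1%:R / (1 - kappa K) * A))).
        rewrite [leRHS](_ : _ = 4 * A); first by apply: ler_peMl => //; rewrite ler1n.
        by field; rewrite nat1r pnatr_eq0 gt_eqF.
      by apply: ler_wpM2r => //; rewrite !mulr_ge0 // invr_ge0 ltW.
    * exact: GPG_reversible.
    * exact: GPG_one.
    * exact: GPG_psd.
    * by move=> v; exact: GPG_poincare.
  (* The constant is halved and the time doubled, so the product is again [4 * A]. *)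
  + apply: (@tmix_le_of_poincare _ _ _ _ Ksym Kdiag hbeta _ (gap (projected K beta) / 2)) => //.
    * by apply/andP; split; lra.
    * by rewrite !mulr_ge0 // invr_ge0 ltW.
    * apply: (@le_trans _ _ ((1 - kappa K) / (2 * m.+1%:R) / 2 * (16 * m.+1%:R / (1 - kappa K) * A))).
        rewrite [leRHS](_ : _ = 4 * A); first by apply: ler_peMl => //; rewrite ler1n.
        by field; rewrite nat1r pnatr_eq0 gt_eqF.
      apply: ler_wpM2r; first by rewrite !mulr_ge0 // invr_ge0 ltW.
      by apply: ler_wpM2r.
    * exact: PG2_reversible.
    * exact: PG2_one.
    * exact: PG2_psd.
    * by move=> v; exact: PG2_poincare.
Qed.
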